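(* Let $\omega:[0,+\infty)\to[0,+\infty)$ be a continuous function such that $\omega(\mu)>0$ for every $\mu>0$ and $\int_1^{+\infty}\frac{\omega(\mu)}{\mu^2}\,d\mu=+\infty$. Let $d$ be a positive integer, let $\Omega\subseteq\mathbb{R}^d$ be a connected open set, and let $u\in L^{\infty}(\Omega)$ be a real-valued function that is not essentially constant and that is approximately differentiable at almost every $x\in\Omega$. Then $\mathscr{F}_\omega(u,\Omega)=+\infty$.
   Context: For a measurable $u:\Omega\to\mathbb{R}$, $$\mathscr{F}_\omega(u,\Omega):=\iint_{\Omega\times\Omega}\omega\left(\frac{|u(y)-u(x)|}{|y-x|}\right)\frac{1}{|y-x|^d}\,dx\,dy\in[0,+\infty].$$ A measurable function is essentially constant if it coincides almost everywhere with a constant. Approximate differentiability (Federer): $u:\Omega\to\mathbb{R}$ is approximately differentiable at $x\in\Omega$ if there is a linear map $L:\mathbb{R}^d\to\mathbb{R}$ such that for every $\varepsilon>0$ the set $\{y\in\Omega: |u(y)-u(x)-L(y-x)|>\varepsilon|y-x|\}$ has Lebesgue density $0$ at $x$. *)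

(* Defs.v *)
From HB Require Import structures.
From mathcomp Require Import all_boot all_order all_algebra.
From mathcomp Require Import all_classical all_reals all_analysis.
From mathcomp Require Import measurable_realfun.
Import Order.TTheory GRing.Theory Num.Theory.
Import numFieldNormedType.Exports.

Set Implicit Arguments.
Unset Strict Implicit.
Unset Printing Implicit Defensive.

Local Open Scope classical_set_scope.
Local Open Scope ring_scope.

Definition rV_display : measure_display -> measure_display.
Proof. exact. Qed.

Section rV_measurable.
Context {R : realType} (n : nat).

Let coors : 'I_n -> 'rV[R]_n -> measurableTypeR R := fun i x => x ord0 i.

Let rV_set0 : g_sigma_preimage coors set0.
Proof. exact: sigma_algebra0. Qed.

Let rV_setC A : g_sigma_preimage coors A -> g_sigma_preimage coors (~` A).
Proof. exact: sigma_algebraC. Qed.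

Let rV_bigcup (F : _^nat) : (forall i, g_sigma_preimage coors (F i)) ->
  g_sigma_preimage coors (\bigcup_i (F i)).
Proof. exact: sigma_algebra_bigcup. Qed.

(* Borel sigma-algebra of R^n, generated by the coordinate functions *)
HB.instance Definition _ := @isMeasurable.Build
  (rV_display default_measure_display)
  'rV[R]_n (g_sigma_preimage coors) rV_set0 rV_setC rV_bigcup.

End rV_measurable.

Lemma measurable_coor {R : realType} n (i : 'I_n) :
  measurable_fun [set: 'rV[R]_n] (fun x => x ord0 i : measurableTypeR R).
Proof.
move=> _ Y mY; rewrite setTI; apply: sub_sigma_algebra => /=.
rewrite -bigcup_seq/=; exists i => /=; first by rewrite mem_index_enum.
by exists Y => //; rewrite setTI.
Qed.

Lemma measurable_fun_rVP {R : realType} d (T : measurableType d) n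
    (f : T -> 'rV[R]_n) :
  (forall i, measurable_fun [set: T]
               (fun t => f t ord0 i : measurableTypeR R)) ->
  measurable_fun [set: T] f.
Proof.
move=> mf.
have sub : g_sigma_preimage
    (fun i t => f t ord0 i : measurableTypeR R) `<=` @measurable d T.
  apply: smallest_sub; first exact: sigma_algebra_measurable.
  case: n => [|n] in f mf *; first by rewrite big_ord0.
  rewrite -bigcup_mkord_ord; apply: bigcup_sub => i Ii.
  by move=> A [B mB <-]; exact: mf.
move=> _ A mA; apply: sub.
have := g_sigma_preimage_comp (fun i (x : 'rV[R]_n) => x ord0 i : measurableTypeR R) f.
by move=> ->; exists A.
Qed.

Definition rV_cons {R : realType} n (p : measurableTypeR R * 'rV[R]_n) :
    'rV[R]_n.+1 :=
  row_mx (p.1 : R)%:M p.2 : 'rV[R]_(1 + n).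

Definition rV_uncons {R : realType} n (x : 'rV[R]_n.+1) :
    measurableTypeR R * 'rV[R]_n :=
  (x ord0 ord0, \row_i x ord0 (lift ord0 i)).

Lemma rV_cons0 {R : realType} n (p : measurableTypeR R * 'rV[R]_n) :
  rV_cons p ord0 ord0 = p.1.
Proof.
have := @row_mxEl R 1 1 n (p.1 : R)%:M p.2 ord0 ord0.
by rewrite [RHS]mxE eqxx mulr1n => <-; congr (rV_cons p _ _); exact: val_inj.
Qed.

Lemma rV_consS {R : realType} n (p : measurableTypeR R * 'rV[R]_n) i :
  rV_cons p ord0 (lift ord0 i) = p.2 ord0 i.
Proof.
rewrite -(@row_mxEr R 1 1 n (p.1 : R)%:M p.2 ord0 i).
by congr (rV_cons p _ _); exact: val_inj.
Qed.

Lemma rV_consK {R : realType} n : cancel (@rV_cons R n) (@rV_uncons R n).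
Proof.
move=> [a x]; congr pair; first exact: rV_cons0.
by apply/rowP => i; rewrite mxE rV_consS.
Qed.

Lemma measurable_rV_cons {R : realType} n :
  measurable_fun [set: measurableTypeR R * 'rV[R]_n] (@rV_cons R n).
Proof.
apply: measurable_fun_rVP => i.
case: (unliftP ord0 i) => [j ->|->].
- under eq_fun do rewrite rV_consS.
  apply: (measurableT_comp (measurable_coor j)); exact: measurable_snd.
- under eq_fun do rewrite rV_cons0.
  exact: measurable_fst.
Qed.

Lemma measurable_rV_uncons {R : realType} n :
  measurable_fun [set: 'rV[R]_n.+1] (@rV_uncons R n).
Proof.
apply/measurable_fun_pairP; split; first exact: measurable_coor.
apply: measurable_fun_rVP => i /=.
under eq_fun do rewrite mxE.
exact: measurable_coor.
Qed.

Section rV_lebesgue_step.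
Local Open Scope ereal_scope.
Context {R : realType} (n : nat).
Variable m : {sigma_finite_measure set 'rV[R]_n -> \bar R}.

Definition rV_lebesgue_step : set 'rV[R]_n.+1 -> \bar R :=
  pushforward (@lebesgue_measure R \x m) (@rV_cons R n).

Let step0 : rV_lebesgue_step set0 = 0.
Proof. by rewrite /rV_lebesgue_step /pushforward preimage_set0 measure0. Qed.

Let step_ge0 A : 0 <= rV_lebesgue_step A.
Proof. by rewrite /rV_lebesgue_step /pushforward measure_ge0. Qed.

Let step_sigma_additive : semi_sigma_additive rV_lebesgue_step.
Proof.
move=> F mF tF mUF; rewrite /rV_lebesgue_step /pushforward preimage_bigcup.
apply: measure_semi_sigma_additive.
- by move=> k; rewrite -[X in measurable X]setTI; exact: measurable_rV_cons.
- apply/trivIsetP => /= i j _ _ ij; rewrite -preimage_setI.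
  by move/trivIsetP : tF => /(_ _ _ _ _ ij) ->//; rewrite preimage_set0.
- rewrite -preimage_bigcup -[X in measurable X]setTI.
  exact: measurable_rV_cons.
Qed.

HB.instance Definition _ := isMeasure.Build _ _ _
  rV_lebesgue_step step0 step_ge0 step_sigma_additive.

Let step_sigma_finite : sigma_finite [set: 'rV[R]_n.+1] rV_lebesgue_step.
Proof.
have /sigma_finiteP[F [TF ndF Foo]] := sigma_finiteT (@lebesgue_measure R).
have /sigma_finiteP[G [TG ndG Goo]] := sigma_finiteT m.
exists (fun k => @rV_uncons R n @^-1` (F k `*` G k)).
  rewrite -preimage_bigcup (_ : \bigcup_k (F k `*` G k) = setT) ?preimage_setT//.
  apply/seteqP; split => // -[x y] _ /=.
  have [i _ Fx] : (\bigcup_i F i) x by rewrite -TF.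
  have [j _ Gy] : (\bigcup_i G i) y by rewrite -TG.
  exists (maxn i j) => //; split.
    by move: x Fx; exact/subsetPset/ndF/leq_maxl.
  by move: y Gy; exact/subsetPset/ndG/leq_maxr.
move=> k; have [mF Fk] := Foo k; have [mG Gk] := Goo k.
have mFG : measurable (F k `*` G k) by exact: measurableX.
split.
  by rewrite -[X in measurable X]setTI; exact: measurable_rV_uncons.
rewrite /rV_lebesgue_step /pushforward -comp_preimage.
rewrite (_ : _ \o _ = id) ?preimage_id; last first.
  by apply/funext => p /=; rewrite rV_consK.
by rewrite product_measure1E// lte_mul_pinfty// ge0_fin_numE.
Qed.

HB.instance Definition _ := Measure_isSigmaFinite.Build _ _ _
  rV_lebesgue_step step_sigma_finite.

End rV_lebesgue_step.

(* Lebesgue measure on the Borel sets of R^n, by R^n.+1 = R * R^n *)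
Fixpoint rV_lebesgue {R : realType} n :
    {sigma_finite_measure set 'rV[R]_n -> \bar R} :=
  match n with
  | 0 => dirac (0 : 'rV[R]_0)
  | k.+1 => rV_lebesgue_step (@rV_lebesgue R k)
  end.

(* R^n equipped with the sigma-algebra of Lebesgue-measurable sets *)
Definition leb_rV (R : realType) n := caratheodory_type (@rV_lebesgue R n)^*%mu.

HB.instance Definition _ (R : realType) n := Measurable.on (leb_rV R n).

Definition leb {R : realType} {n} : set (leb_rV R n) -> \bar R :=
  @completed_measure_extension _ _ _ (@rV_lebesgue R n).

HB.instance Definition _ (R : realType) n := Measure.on (@leb R n).

Lemma leb_sigma_finite (R : realType) n : sigma_finite setT (@leb R n).
Proof. exact/completed_measure_extension_sigma_finite/sigma_finiteT. Qed.

HB.instance Definition _ (R : realType) n :=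
  Measure_isSigmaFinite.Build _ _ _ (@leb R n) (@leb_sigma_finite R n).

(* the library's norm on matrices is the sup norm *)
Definition enorm {R : realType} {n} (x : 'rV[R]_n) : R :=
  Num.sqrt (\sum_i x ord0 i ^+ 2).

Definition eball {R : realType} {n} (x : 'rV[R]_n) (r : R) : set 'rV[R]_n :=
  [set y | enorm (y - x) < r].

Definition density0 {R : realType} {n} (E : set 'rV[R]_n) (x : 'rV[R]_n) :
    Prop :=
  (leb (E `&` eball x r) * (leb (eball x r))^-1)%E @[r --> 0^'+] --> 0%E.

Definition approx_differentiable {R : realType} {n} (Omega : set 'rV[R]_n)
    (u : 'rV[R]_n -> R) (x : 'rV[R]_n) : Prop :=
  exists L : {linear 'rV[R]_n -> R^o}, forall eps : R, 0 < eps ->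
    density0 [set y | Omega y /\
                      eps * enorm (y - x) < `|u y - u x - L (y - x)|] x.

Definition ess_constant {R : realType} {n} (Omega : set 'rV[R]_n)
    (u : 'rV[R]_n -> R) : Prop :=
  exists c : R, {ae @leb R n, forall x, Omega x -> u x = c}.

(* u is a total function whose values outside Omega are irrelevant; the
   L^oo norm over Omega is that of the extension of u by 0 *)
Definition Linfty {R : realType} {n} (Omega : set 'rV[R]_n)
    (u : 'rV[R]_n -> R) : Prop :=
  measurable_fun (Omega : set (leb_rV R n)) (u : leb_rV R n -> R) /\
  ('N[@leb R n]_+oo [EFin \o (u \_ Omega)] < +oo)%E.

(* both quotients are 0 on the diagonal, which is negligible for n > 0 *)
Definition nonlocal_energy {R : realType} {n} (omega : R -> R)
    (u : 'rV[R]_n -> R) (Omega : set 'rV[R]_n) : \bar R :=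
  (\int[@leb R n \x @leb R n]_(z in Omega `*` Omega)
    (omega (`|u z.2 - u z.1| / enorm (z.2 - z.1))
      * (enorm (z.2 - z.1) ^+ n)^-1)%:E)%E.

(* Main.v *)
Require Import Defs.
From HB Require Import structures.
From mathcomp Require Import all_boot all_order all_algebra.
From mathcomp Require Import all_classical all_reals all_analysis.
From mathcomp Require Import measurable_realfun.
From mathcomp Require Import ring lra ess_sup_inf.
Import Order.TTheory GRing.Theory Num.Theory.
Import numFieldNormedType.Exports.

(** Suppose that the energy of u is finite. The claim is that u is then almost
everywhere equal to a constant.

Let x be a point where u has an approximate differential L <> 0. For y in a
suitable cone at x, and outside a set of density zero, the quotient
|u(y) - u(x)| / |y - x| stays in a compact subset of ]0, +oo[, where omega is
bounded below. Since |y - x|^-d has infinite integral over a cone, the energy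
density at x is infinite ([nonzero_differential_infinite]). So L = 0 at almost
every point. A Lusin type decomposition then shows that, for every eps > 0, u
is eps-Lipschitz at small scale on each of countably many Borel sets that
cover almost all of Omega ([rV_flat_of_zero_adiff]). Contrary to approximate
differentiability at single points, this property passes to almost every line
([flat_line]).

With y - x = (t - s) (1, z), the energy of pairs of points becomes an
integral, over the lines directed by (1, z), of one-dimensional energies
([integral_pair_line]), and the heart of the proof is the one-dimensional
statement ([line_energy_constant]). Let w be bounded and flat in the above
sense on an interval, let w a < w b at two good points a < b, and let nu be a
large slope. The map x |-> w x - nu x expands by nearly nu on small pieces,
and its values essentially lie in an interval that is shorter than
nu (b - a) by almost w b - w a. An injective map of this kind would create
too much measure ([measure_expansion]). Hence the set X_nu of the points
x of ]a, b[ from which another good point y is seen with slope exactly nu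
has measure at least (w b - w a) / (2 nu) ([excess_measure]). Near such a y
the function w is nearly constant, so that the slope, as a function of y, has
derivative - nu / (y - x); thus, up to sign, dy / (y - x) = d nu / nu, and the energy of w
dominates the integral of omega(nu) / nu * |X_nu|, which is at least a
multiple of the integral of omega(nu) / nu^2, that is +oo. This change of
variables from y to nu would require an area formula; [fatou_window] replaces
it by averages over small windows of slopes and by the lemma of Fatou.

It follows that u is almost everywhere constant on almost every chord of a
ball contained in Omega, hence u(x) = u(y) for almost all pairs of points of the ball
([finite_energy_pairs]), and u is locally constant almost everywhere. Since
Omega is connected, the local constants agree ([ae_value_connected]).

All this takes place with Borel sets and Borel functions, where the theorem of
Tonelli can be applied to slices. The reduction modifies u on a null set
([completion_fun_borel]); neither the approximate differentials
([adiff_of_approx]) nor the energy ([integral_lebpair]) are affected. *)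

Set Implicit Arguments.
Unset Strict Implicit.
Unset Printing Implicit Defensive.
Local Open Scope classical_set_scope.
Local Open Scope ring_scope.

(** * Lebesgue measure and norms on row vectors *)

Section rV_integral.
Local Open Scope ereal_scope.
Context {R : realType}.

(** The defining recursion of the measure, read on integrals; all changes of
variables below reduce to dimension one through it. *)
Lemma ge0_integral_rVS n (f : 'rV[R]_n.+1 -> \bar R) :
  measurable_fun setT f -> (forall x, 0 <= f x) ->
  \int[@rV_lebesgue R n.+1]_x f x =
  \int[@lebesgue_measure R]_s \int[@rV_lebesgue R n]_x f (rV_cons (s, x)).
Proof.
move=> mf f0.
transitivity (\int[(@lebesgue_measure R \x @rV_lebesgue R n)]_p
    (f \o @rV_cons R n) p).
  rewrite -[in RHS](preimage_setT (@rV_cons R n)).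
  rewrite -(ge0_integral_pushforward (@measurable_rV_cons R n)) //.
rewrite fubini_tonelli1//.
  exact: measurableT_comp mf (@measurable_rV_cons R n).
by move=> x /=.
Qed.

Lemma ge0_integral_affine (f : R -> \bar R) (a c : R) : c != 0%R ->
  measurable_fun setT f -> (forall x, 0 <= f x) ->
  \int[@lebesgue_measure R]_x f x =
  `|c|%:E * \int[@lebesgue_measure R]_x f (a + c * x)%R.
Proof.
move=> c0 mf f0.
have mphi : measurable_fun [set: measurableTypeR R]
    (fun x : measurableTypeR R => (a + c * x)%R : measurableTypeR R).
  by apply: measurable_funD => //; exact: measurable_funM.
pose pm : {measure set (measurableTypeR R) -> \bar R} :=
  measure_function_pushforward__canonical__measure_function_Measure
    (@lebesgue_measure R) mphi.
pose k : {nonneg R} := NngNum (normr_ge0 c).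
transitivity (\int[mscale k pm]_x f x).
  apply: eq_measure_integral => A mA _.
  apply: (@lebesgue_measure_unique R (mscale k pm)) => //.
  move=> _ [[p q] /= _ <-].
  rewrite /mscale /= /pushforward /=.
  have cgt : (0 < `|c|)%R by rewrite normr_gt0.
  have [c1|c1] := ltP 0%R c.
    have -> : ((fun x : measurableTypeR R => (a + c * x)%R) @^-1` `]p, q])%classic =
      `]((p - a)/c)%R, ((q - a)/c)%R]%classic.
      apply/seteqP; split => x /=; rewrite !in_itv/= ltr_pdivrMr// ler_pdivlMr//
        ltrBlDl lerBrDl [(c * x)%R]mulrC //.
    rewrite !lebesgue_measure_itv /= !lte_fin ltr_pM2r ?invr_gt0// ltrD2r.
    case: ifP => _; rewrite ?mule0// -!EFinD -EFinM gtr0_norm//.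
    by congr (_ %:E); field.
  have {}c1 : (c < 0)%R by rewrite lt_neqAle c0.
  have -> : ((fun x : measurableTypeR R => (a + c * x)%R) @^-1` `]p, q])%classic =
      `[((q - a)/c)%R, ((p - a)/c)%R[%classic.
    apply/seteqP; split => x /=; rewrite !in_itv/= ltr_ndivlMr// ler_ndivrMr//
        ltrBlDl lerBrDl [(c * x)%R]mulrC andbC //.
  rewrite !lebesgue_measure_itv /= !lte_fin ltr_nM2r ?invr_lt0// ltrD2r.
  case: ifP => _; rewrite ?mule0// -!EFinD -EFinM ltr0_norm//.
  by congr (_ %:E); field.
rewrite ge0_integral_mscale//=.
by rewrite (ge0_integral_pushforward mphi).
Qed.

Lemma measurable_rV_affine n (a : 'rV[R]_n) (c : R) :
  measurable_fun setT (fun x : 'rV[R]_n => a + c *: x : 'rV[R]_n)%R.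
Proof.
apply: measurable_fun_rVP => i.
under eq_fun do rewrite !mxE.
apply: measurable_funD => //; apply: measurable_funM => //.
exact: measurable_coor.
Qed.

Lemma rV_cons_affine n (a : 'rV[R]_n.+1) (c s : R) (x : 'rV[R]_n) :
  (a + c *: rV_cons (s, x) = rV_cons ((a ord0 ord0 + c * s), ((rV_uncons a).2 + c *: x)))%R.
Proof.
apply/rowP => i; case: (unliftP ord0 i) => [j ->|->];
  rewrite [LHS]mxE [X in (_ + X = _)%R]mxE.
- by rewrite !rV_consS !mxE.
- by rewrite !rV_cons0.
Qed.

Lemma ge0_integral_rV_affine n (f : 'rV[R]_n -> \bar R) (a : 'rV[R]_n) (c : R) :
  c != 0%R -> measurable_fun setT f -> (forall x, 0 <= f x) ->
  \int[@rV_lebesgue R n]_x f x =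
  (`|c| ^+ n)%:E * \int[@rV_lebesgue R n]_x f (a + c *: x)%R.
Proof.
move=> c0; elim: n f a => [|n IH] f a mf f0.
  rewrite expr0 mul1e; apply: eq_integral => x _.
  by congr f; apply/rowP => -[].
have mfa : measurable_fun setT (fun x : 'rV[R]_n.+1 => f (a + c *: x)%R).
  by apply: (measurableT_comp mf); exact: measurable_rV_affine.
rewrite ge0_integral_rVS// ge0_integral_rVS//.
have mF (g : 'rV[R]_n.+1 -> \bar R) : measurable_fun setT g ->
    (forall x, 0 <= g x) ->
    measurable_fun setT (fun s : measurableTypeR R =>
      \int[@rV_lebesgue R n]_x g (rV_cons (s, x))).
  move=> mg g0.
  apply: (measurable_fun_fubini_tonelli_F (m2 := rV_lebesgue n) (g \o @rV_cons R n)).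
    by apply: (measurableT_comp mg); exact: measurable_rV_cons.
  by move=> x /=.
have F0 (g : 'rV[R]_n.+1 -> \bar R) s : (forall x, 0 <= g x) ->
    0 <= \int[@rV_lebesgue R n]_x g (rV_cons (s, x)).
  by move=> g0; apply: integral_ge0 => x _; exact: g0.
rewrite (ge0_integral_affine (a ord0 ord0) c0 (mF f mf f0) (fun s => F0 f s f0)).
rewrite exprS EFinM -muleA; congr (_ * _).
rewrite -ge0_integralZl//; [|exact: mF mfa _|by move=> s _; apply: (F0 (fun x => f (a + c *: x)%R))].
apply: eq_integral => s _.
rewrite (IH _ (rV_uncons a).2)//.
  by congr (_ * _); apply: eq_integral => x _; rewrite rV_cons_affine.
apply: (measurableT_comp mf).
apply: (measurableT_comp (@measurable_rV_cons R n)).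
exact: measurable_pair1.
Qed.

End rV_integral.

Section rV_geometry.
Context {R : realType}.

Lemma ball_rVP n (c : 'rV[R]_n) (r : R) (y : 'rV[R]_n) : 0 < r ->
  ball c r y <-> forall i, `|c ord0 i - y ord0 i| < r.
Proof.
move=> r0; split=> [[_ h] i|h]; first exact: h.
by split=> // i j; rewrite (ord1 i); exact: h.
Qed.

Lemma measurable_ball_rV n (c : 'rV[R]_n) (r : R) : measurable (ball c r).
Proof.
have [r0|r0] := leP r 0.
  by rewrite (_ : ball c r = set0)//; apply/seteqP; split=> // y [] /lt_le_trans/(_ r0); rewrite ltxx.
rewrite (_ : ball c r = \bigcap_(i in [set: 'I_n])
    ((fun x : 'rV[R]_n => x ord0 i : measurableTypeR R) @^-1` ball (c ord0 i) r)); last first.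
  apply/seteqP; split=> [y /(ball_rVP _ _ r0) h i _|y h]; first exact: h.
  by apply/ball_rVP => // i; exact: h.
apply: fin_bigcap_measurable => // i _.
by rewrite -[X in measurable X]setTI; apply: measurable_coor => //; exact: measurable_ball.
Qed.

Lemma rV_lebesgue_ball n (c : 'rV[R]_n) (r : R) : 0 < r ->
  rV_lebesgue n (ball c r) = ((r *+ 2) ^+ n)%:E.
Proof.
move=> r0; elim: n c => [|n IH] c.
  by rewrite /= expr0 diracE mem_set//; apply/ball_rVP => // -[].
rewrite -[LHS]/((@lebesgue_measure R \x rV_lebesgue n)%E (@rV_cons R n @^-1` ball c r)).
rewrite (_ : _ @^-1` _ = (ball (c ord0 ord0) r : set (measurableTypeR R)) `*` ball (rV_uncons c).2 r).
  rewrite product_measure1E//; [|exact: measurable_ball|exact: measurable_ball_rV].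
  by rewrite exprS EFinM -(IH (rV_uncons c).2) -(lebesgue_measure_ball (c ord0 ord0) (ltW r0)).
apply/seteqP; split=> [[s x] /(ball_rVP _ _ r0) h|[s x] [h0 /(ball_rVP _ _ r0) h]].
  split; first by have := h ord0; rewrite rV_cons0.
  by apply/ball_rVP => // i; have := h (lift ord0 i); rewrite rV_consS mxE.
apply/ball_rVP => // i; case: (unliftP ord0 i) => [j ->|->].
  by have := h j; rewrite rV_consS mxE.
by rewrite rV_cons0.
Qed.

(** The countable base of open sets used for measurability and for covering
arguments. *)
Definition rat_ball n (p : 'rV[rat]_n * nat) : set 'rV[R]_n :=
  ball (\row_i ratr (p.1 ord0 i) : 'rV[R]_n) (p.2.+1%:R^-1).

Lemma rat_ball_nbhs n (x : 'rV[R]_n) (e : R) : 0 < e ->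
  exists p, rat_ball p x /\ rat_ball p `<=` ball x e.
Proof.
move=> e0.
have [k ke] : exists k : nat, k.+1%:R^-1 < e / 2.
  have [k _ /(_ k)] := near_infty_natSinv_lt (PosNum (divr_gt0 e0 (@ltr0Sn R 1))).
  by move=> /(_ (leqnn _)) /=; exists k.
have k0 : 0 < k.+1%:R^-1 :> R by rewrite invr_gt0.
have qP i : {q : rat | `|ratr q - x ord0 i| < k.+1%:R^-1}.
  apply: cid.
  have /rat_in_itvoo[q /itvP qq] : x ord0 i - k.+1%:R^-1 < x ord0 i + k.+1%:R^-1.
    by rewrite ltrBlDr -addrA ltrDl addr_gt0.
  by exists q; rewrite ltr_distl !qq.
pose q : 'rV[rat]_n := \row_i projT1 (qP i).
have Bx : rat_ball (q, k) x.
  by apply/ball_rVP => // i; rewrite !mxE; case: (qP i).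
exists (q, k); split => // y qy.
have := ball_triangle (ball_sym Bx) qy.
by apply: le_ball => /=; rewrite [leRHS]splitr lerD// ltW.
Qed.

Lemma open_measurable_rV n (U : set 'rV[R]_n) : open U -> measurable U.
Proof.
move=> oU.
rewrite (_ : U = \bigcup_p (if `[< @rat_ball n p `<=` U >] then rat_ball p else set0)).
  apply: countable_bigcupT_measurable => // p.
  by case: ifP => // _; exact: measurable_ball_rV.
apply/seteqP; split=> [x Ux|x [p _]]; last by case: ifPn => // /asboolP; exact.
have : nbhs x U by exact: open_nbhs_nbhs.
rewrite -nbhs_ballE => -[e /= e0 eU].
have [p [px pe]] := rat_ball_nbhs x e0.
by exists p => //; rewrite ifT//; apply/asboolP; exact: subset_trans eU.
Qed.

Lemma enorm_ge0 n (x : 'rV[R]_n) : 0 <= enorm x.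
Proof. exact: sqrtr_ge0. Qed.

Lemma coor_le_enorm n (x : 'rV[R]_n) i : `|x ord0 i| <= enorm x.
Proof.
rewrite -sqrtr_sqr; apply: ler_wsqrtr.
by rewrite (bigD1 i)//= lerDl; apply: sumr_ge0 => j _; exact: sqr_ge0.
Qed.

(** The optimal constant is the square root of n; the estimates below are
insensitive to the constant, and always pass from the Euclidean norm to
coordinates and back. *)
Lemma enorm_le_coor n (x : 'rV[R]_n) (b : R) : 0 <= b ->
  (forall i, `|x ord0 i| <= b) -> enorm x <= n%:R * b.
Proof.
move=> b0 xb; rewrite -[leRHS]ger0_norm ?mulr_ge0// -sqrtr_sqr; apply: ler_wsqrtr.
apply: (@le_trans _ _ (\sum_(i < n) b ^+ 2)).
  by apply: ler_sum => i _; rewrite -real_normK ?num_real// lerXn2r ?nnegrE.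
rewrite sumr_const card_ord exprMn -[leLHS]mulr_natl ler_wpM2r ?sqr_ge0//.
by case: n x xb => [|n] _ _; rewrite ?expr0n// expr2 ler_peMl// ler1n.
Qed.

Lemma enormZ n (c : R) (x : 'rV[R]_n) : enorm (c *: x) = `|c| * enorm x.
Proof.
rewrite /enorm -sqrtr_sqr -sqrtrM ?sqr_ge0//; congr Num.sqrt.
by rewrite mulr_sumr; apply: eq_bigr => i _; rewrite mxE exprMn.
Qed.

Lemma enorm0 n : enorm (0 : 'rV[R]_n) = 0.
Proof. by rewrite -[0](scale0r 0) enormZ normr0 mul0r. Qed.

Lemma enorm_eq0 n (x : 'rV[R]_n) : enorm x = 0 -> x = 0.
Proof.
move=> x0; apply/rowP => i; rewrite mxE; apply/normr0_eq0/le_anti.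
by rewrite normr_ge0 andbT -x0 coor_le_enorm.
Qed.

Lemma measurable_enorm d (T : measurableType d) n (f : T -> 'rV[R]_n) :
  measurable_fun setT f -> measurable_fun setT (fun t => enorm (f t)).
Proof.
move=> mf; apply: (measurableT_comp (continuous_measurable_fun (@sqrt_continuous R))).
apply: measurable_sum => i; apply: measurable_funX.
exact: (measurableT_comp (measurable_coor i)).
Qed.

End rV_geometry.

(** * Averages over windows of slopes *)

Section fatou_window.
Local Open Scope ereal_scope.
Context {R : realType} d1 d2 (T1 : measurableType d1) (T2 : measurableType d2).
Variables (m1 : {sigma_finite_measure set T1 -> \bar R})
  (m2 : {sigma_finite_measure set T2 -> \bar R}).
Variables (K : T1 * T2 -> \bar R) (q : T1 * T2 -> R).
Hypotheses (mK : measurable_fun setT K) (K0 : forall z, 0 <= K z).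
Hypothesis mq : measurable_fun setT q.

Definition window (k : nat) (nu : R) : set (T1 * T2) :=
  [set z | `|q z - nu| < k.+1%:R^-1]%R.

(** The factor (k+1)/2 normalizes the length of the window, so that
integrating over nu gives back the integral of K in y. *)
Definition window_avg (k : nat) (nu : R) (x : T1) : \bar R :=
  \int[m2]_y (K (x, y) * (k.+1%:R / 2 * \1_(window k nu) (x, y))%:E).

(** This plays the part of the density, at slope nu, of the image of K (x, y)
dy by the slope map y |-> q (x, y). *)
Definition slice_density (nu : R) (x : T1) : \bar R :=
  limn_einf (fun k => window_avg k nu x).

Local Notation lebR := (@lebesgue_measure R).

Let F k (p : (measurableTypeR R * T1) * T2) : \bar R :=
  K (p.1.2, p.2) * (k.+1%:R / 2 * \1_(window k p.1.1) (p.1.2, p.2))%:E.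

Let F0 k p : 0 <= F k p.
Proof.
by rewrite /F mule_ge0// lee_fin mulr_ge0// divr_ge0.
Qed.

Let mF k : measurable_fun setT (F k).
Proof.
have mz : measurable_fun setT
    (fun p : (measurableTypeR R * T1) * T2 => (p.1.2, p.2)).
  apply: measurable_fun_pair => //.
  exact: (measurableT_comp measurable_snd measurable_fst).
apply: emeasurable_funM; first exact: (measurableT_comp mK mz).
apply/measurable_EFinP; apply: measurable_funM => //.
rewrite (_ : (fun _ => _) = \1_[set p : (measurableTypeR R * T1) * T2 |
    (`|q (p.1.2, p.2) - p.1.1| < k.+1%:R^-1)%R]).
  apply: measurable_indic.
  rewrite -[X in measurable X]setTI.
  have : measurable_fun setT (fun p : (measurableTypeR R * T1) * T2 =>
      (`|q (p.1.2, p.2) - p.1.1| < k.+1%:R^-1)%R).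
    apply: measurable_fun_ltr => //; apply: measurableT_comp => //.
    apply: measurable_funB; first exact: (measurableT_comp mq mz).
    exact: (measurableT_comp measurable_fst measurable_fst).
  by move=> /(_ measurableT [set true]); exact.
by apply/funext => p; rewrite /window !indicE; congr (_%:R); congr nat_of_bool;
  apply/idP/idP; rewrite !inE.
Qed.

Lemma measurable_window_section k nu x : measurable_fun setT
  (fun y => K (x, y) * (k.+1%:R / 2 * \1_(window k nu) (x, y))%:E).
Proof.
apply: (measurableT_comp (mF k) (_ : measurable_fun setT
  (fun y => ((nu : measurableTypeR R, x), y)))).
exact: measurable_pair1.
Qed.

Lemma measurable_window_avg k :
  measurable_fun setT (fun p : measurableTypeR R * T1 => window_avg k p.1 p.2).
Proof.
exact: (measurable_fun_fubini_tonelli_F (m2 := m2) (F k) (mF k) (F0 k)).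
Qed.

Lemma measurable_slice_density :
  measurable_fun setT (fun p : measurableTypeR R * T1 => slice_density p.1 p.2).
Proof.
rewrite /slice_density /limn_einf.
apply: measurableT_comp => //.
apply: measurable_fun_limn_esup => k.
by apply: measurableT_comp => //; exact: measurable_window_avg.
Qed.

Lemma window_avg_ge0 k nu x : 0 <= window_avg k nu x.
Proof. by apply: integral_ge0 => y _; exact: (F0 k ((nu, x), y)). Qed.

Lemma limn_einf_ge (u : (\bar R)^nat) c N :
  (forall k, (N <= k)%N -> c <= u k) -> c <= limn_einf u.
Proof.
move=> h; rewrite limn_einf_lim; apply: lime_ge; first exact: is_cvg_einfs.
near=> n; apply: le_ereal_inf_tmp => _ [k /= nk <-]; apply: h.
by apply: leq_trans nk; near: n; exists N.
Unshelve. all: by end_near. Qed.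

Lemma slice_density_ge0 nu x : 0 <= slice_density nu x.
Proof. by apply: (@limn_einf_ge _ _ 0%N) => k _; apply: window_avg_ge0. Qed.

(** For each k, integrating [window_avg] over all nu and x gives the integral
of K, because the windows around a given slope have total mass 1. The lemma of
Fatou then bounds the integral of the limit from above. The slope map only
enters through averages, so that this inequality, for a merely measurable map,
can stand for an area formula. *)
Lemma fatou_window :
  \int[lebR]_nu \int[m1]_x slice_density nu x <= \int[m1]_x \int[m2]_y K (x, y).
Proof.
rewrite -(fubini_tonelli1 (m1 := lebR) (m2 := m1)
  (fun p : measurableTypeR R * T1 => slice_density p.1 p.2)); last 2 first.
- exact: measurable_slice_density.
- by move=> p; exact: slice_density_ge0.
apply: le_trans (fatou _ _ _ _) _ => //.
- by move=> k; exact: measurable_window_avg.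
- by move=> k p _; exact: window_avg_ge0.
rewrite (_ : (fun _ => _) = cst (\int[m1]_x \int[m2]_y K (x, y))).
  by have [-> _] := cvg_limn_einf_sup (@cvg_cst _ (\int[m1]_x \int[m2]_y K (x, y)) _ \oo _).
apply/funext => k /=.
rewrite (fubini_tonelli2 (m1 := lebR) (m2 := m1)
  (fun p : measurableTypeR R * T1 => window_avg k p.1 p.2)); last 2 first.
- exact: measurable_window_avg.
- by move=> p; exact: window_avg_ge0.
apply: eq_integral => x _.
have mFx : measurable_fun setT
    (fun p : measurableTypeR R * T2 => F k ((p.1, x), p.2)).
  apply: (measurableT_comp (mF k)).
  apply: measurable_fun_pair => //.
  by apply: measurable_fun_pair => //.
rewrite /fubini_G /= /window_avg.
rewrite (fubini_tonelli (m1 := lebR) (m2 := m2)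
   (fun p : measurableTypeR R * T2 => F k ((p.1, x), p.2))) //.
apply: eq_integral => y _.
have IE : (fun nu : R => \1_(window k nu) (x, y) : R) =
    \1_(ball (q (x, y)) k.+1%:R^-1%R).
  by apply/funext => nu; rewrite !indicE.
have mI : measurable_fun setT (fun nu : measurableTypeR R =>
    (\1_(window k nu) (x, y) : R)).
  by rewrite IE; apply: measurable_indic; exact: measurable_ball.
rewrite /F /= ge0_integralZl//;
  last by apply/measurable_EFinP; exact: measurable_funM.
rewrite (_ : \int[_]_ _ _ = 1) ?mule1//.
under eq_integral do rewrite EFinM.
rewrite ge0_integralZl//; last exact/measurable_EFinP.
under eq_integral do rewrite (congr1 (fun f => f _) IE).
rewrite integral_indic//; last exact: measurable_ball.
transitivity ((k.+1%:R / 2)%:E * (k.+1%:R^-1 *+ 2)%:E : \bar R).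
  by congr (_ * _); rewrite setIT; apply: lebesgue_measure_ball; rewrite invr_ge0.
rewrite -EFinM; congr EFin.
by rewrite -[X in (_ * X)%R]mulr_natl mulrA divfK ?divff.
Qed.

End fatou_window.

(** * Expansion of measure by an injective map *)

Section expansion.
Context {R : realType}.
Local Notation mu := (@lebesgue_measure R).
Implicit Types (v w : R -> R) (K Y : set R).

Lemma lebesgue_measure_diam (A : set R) (l : R) : measurable A -> 0 <= l ->
  (forall x y, A x -> A y -> x - y <= l) -> (mu A <= l%:E)%E.
Proof.
move=> mA l0 Al.
have [->|/set0P[x0 Ax0]] := eqVneq A set0; first by rewrite measure0 lee_fin.
have lbA : has_lbound A.
  by exists (x0 - l) => y Ay; rewrite lerBlDr -lerBlDl Al.
have ubA : has_ubound A.
  by exists (x0 + l) => y Ay; rewrite -lerBlDl Al.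
have subA : A `<=` `[inf A, sup A]%classic.
  by move=> y Ay /=; rewrite in_itv/= ge_inf// ub_le_sup.
apply: (@le_trans _ _ (mu `[inf A, sup A]%classic)).
  by apply: le_measure; rewrite ?inE.
rewrite lebesgue_measure_itv/= lte_fin; case: ifP => _; last by rewrite lee_fin.
rewrite -EFinB lee_fin lerBlDl -lerBlDr.
apply: lb_le_inf; first by exists x0.
move=> y Ay; rewrite lerBlDr; apply: sup_le_ub; first by exists x0.
by move=> x Ax; rewrite addrC -lerBlDr Al.
Qed.

(** This is the uniform continuity of the inverse: on the compact set of the
pairs of points of K at distance at least del, the positive continuous
function |v x - v y| is bounded away from 0. *)
Lemma injective_separation v K (del : R) : compact K ->
  {within K, continuous v} -> {in K &, injective v} -> 0 < del ->
  exists2 tau, 0 < tau &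
    forall x y, K x -> K y -> `|v x - v y| < tau -> `|x - y| < del.
Proof.
move=> cK cv vinj del0.
pose C : set (R * R) := (K `*` K) `&` [set p | del <= `|p.1 - p.2|].
have cC : compact C.
  apply: subclosed_compact (compact_setX cK cK) _; last exact: subIsetl.
  apply: closedI.
    by apply: compact_closed; [exact: norm_hausdorff|exact: compact_setX].
  apply: (@closed_comp _ _ (fun p : R * R => `|p.1 - p.2|) [set x | del <= x]).
    move=> p _; apply: cvg_norm; apply: cvgB; [exact: cvg_fst|exact: cvg_snd].
  exact: closed_ge.
pose g (p : R * R) := `|v p.1 - v p.2|.
have cg : {within C, continuous g}.
  apply/subspace_continuousP => -[x y] [[/= Kx Ky] _].
  move/subspace_continuousP : cv => cv.
  apply: cvg_norm; apply: cvgB.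
    apply: (cvg_comp _ _ _ (cv _ Kx)) => P KP.
    exists ([set t | K t -> P t], setT); first by split => //=; exact: filterT.
    by move=> [s t] /= [KPs _] [[Ks _] _]; exact: KPs.
  apply: (cvg_comp _ _ _ (cv _ Ky)) => P KP.
  exists (setT, [set t | K t -> P t]); first by split => //=; exact: filterT.
  by move=> [s t] /= [_ KPs] [[_ Ks] _]; exact: KPs.
have := continuous_compact cg cC.
move=> /compact_closed -/(_ (@norm_hausdorff _ _)) cl.
have n0 : ~ (g @` C) 0.
  move=> [[x y] [[/= Kx Ky] dxy]] /eqP; rewrite normr_eq0 subr_eq0 => /eqP.
  by move=> /vinj -/(_ (mem_set Kx) (mem_set Ky)) /= xy; move: dxy; rewrite /= xy subrr normr0 leNgt del0.
have [tau /= tau0 H] : nbhs (0 : R) (~` (g @` C)).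
  by apply: open_nbhs_nbhs; split => //; exact: closed_openC.
exists tau => // x y Kx Ky xy; rewrite ltNge; apply/negP => dxy.
apply: (H (g (x, y))); last by exists (x, y).
by rewrite /= sub0r normrN normr_id.
Qed.


(** The Lipschitz condition is only local, at scale del, hence gives
continuity. *)
Lemma lipschitz_continuous_within w K (eps del nu : R) : 0 <= eps -> 0 < del ->
  (forall x y, K x -> K y -> `|x - y| < del -> `|w x - w y| <= eps * `|x - y|) ->
  {within K, continuous (fun x => w x - nu * x)}.
Proof.
move=> eps0 del0 wlip; apply/subspace_continuousP => x Kx.
apply: cvgB; last first.
  by apply: cvg_within_filter; apply: cvgM; [exact: cvg_cst|exact: cvg_id].
apply/cvgrPdist_lt => e e0; rewrite near_withinE.
near=> y => Ky.
apply: (@le_lt_trans _ _ (eps * `|x - y|)).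
  by apply: wlip => //; near: y; exact: cvgr_dist_lt.
apply: (@le_lt_trans _ _ ((eps + 1) * `|x - y|)).
  by rewrite ler_wpM2r// lerDl.
rewrite mulrC -ltr_pdivlMr ?ltr_wpDl//; near: y; apply: cvgr_dist_lt => //.
by rewrite divr_gt0// ltr_wpDl.
Unshelve. all: by end_near. Qed.

(** Cut the range ]a, b[ into pieces so short that, by [injective_separation],
the preimage of each piece has diameter smaller than del. On such a preimage
the map x |-> w x - nu x expands distances by nu - eps, so the preimage of a
piece of length l has measure at most l / (nu - eps); the sum over the pieces
is the claim. *)
Lemma compact_expansion w K (eps del nu a b : R) : measurable_fun setT w ->
  compact K -> 0 <= eps -> eps < nu -> 0 < del -> a < b ->
  (forall x y, K x -> K y -> `|x - y| < del -> `|w x - w y| <= eps * `|x - y|) ->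
  (forall x y, K x -> K y -> w x - nu * x = w y - nu * y -> x = y) ->
  (forall x, K x -> a <= w x - nu * x <= b) ->
  (mu K <= ((b - a) / (nu - eps))%:E)%E.
Proof.
move=> mw cK eps0 epsnu del0 ab wlip vinj vab.
have mK := compact_measurable cK.
pose v x := w x - nu * x.
have [tau tau0 Htau] : exists2 tau, 0 < tau &
    forall x y, K x -> K y -> `|v x - v y| < tau -> `|x - y| < del.
  apply: injective_separation => //.
    exact: lipschitz_continuous_within wlip.
  by move=> x y /set_mem Kx /set_mem Ky; exact: vinj.
have [N HN] : exists N : nat, (b - a) / N.+1%:R < tau.
  exists (Num.truncn ((b - a) / tau)).
  by rewrite ltr_pdivrMr// mulrC -ltr_pdivrMr// truncnS_gt.
pose l := (b - a) / N.+1%:R.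
have l0 : 0 < l by rewrite divr_gt0 ?subr_gt0.
have Nl : N.+1%:R * l = b - a by rewrite mulrC divfK.
pose J (j : nat) := K `&` (v @^-1` `[a + j%:R * l, a + j.+1%:R * l]%classic).
have mv : measurable_fun setT v.
  by apply: measurable_funB => //; exact: measurable_funM.
have mJ j : measurable (J j).
  apply: measurableI => //; rewrite -[X in measurable X]setTI.
  exact: mv.
have KJ : K `<=` \big[setU/set0]_(j < N.+1) J j.
  move=> x Kx; rewrite -bigcup_mkord.
  have /andP[va vb] := vab _ Kx.
  have [vxb|bv] := ltP (v x) b; last first.
    exists N => //=; split => //=; rewrite in_itv/= -/(v x).
    have -> : v x = b by apply/le_anti; rewrite bv vb.
    by rewrite Nl subrKC lexx andbT -lerBrDl -Nl ler_pM2r ?ler_nat.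
  have xl : 0 <= (v x - a) / l by rewrite divr_ge0 ?subr_ge0// ltW.
  exists (Num.truncn ((v x - a) / l)) => /=.
    by rewrite truncn_lt_nat// ltr_pdivrMr// Nl ltrD2r.
  split => //=; rewrite in_itv/=; apply/andP; split.
    by rewrite -lerBrDl -ler_pdivlMr// truncn_le.
  by rewrite -lerBlDl -ler_pdivrMr// ltW// truncnS_gt.
have Jl j : (mu (J j) <= (l / (nu - eps))%:E)%E.
  apply: lebesgue_measure_diam => //.
    by rewrite divr_ge0 ?subr_ge0// ltW.
  move=> x y [Kx]; rewrite /= in_itv/= => /andP[x1 x2] [Ky].
  rewrite /= in_itv/= => /andP[y1 y2].
  have vxy : `|v x - v y| <= l.
    move: x1 x2 y1 y2; rewrite -!natr1 ler_norml mulrDl mul1r => ? ? ? ?.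
    by apply/andP; split; lra.
  have xyd : `|x - y| < del by apply: Htau => //; exact: le_lt_trans HN.
  have wxy := wlip _ _ Kx Ky xyd.
  apply: (le_trans (ler_norm _)).
  rewrite ler_pdivlMr ?subr_gt0// mulrBr lerBlDr [`|x - y| * eps]mulrC.
  apply: le_trans (lerD vxy wxy).
  rewrite -[X in _ * X]gtr0_norm ?(le_lt_trans eps0)// -normrM.
  rewrite (_ : (x - y) * nu = (w x - w y) - (v x - v y)); last by rewrite /v; ring.
  by rewrite [leRHS]addrC; exact: ler_normB.
apply: (@le_trans _ _ (\sum_(j < N.+1) mu (J j))%E).
  have H := @content_subadditive _ _ _ mu _ _ _ (fun j _ => mJ j) mK KJ.
  exact: H.
apply: (@le_trans _ _ (\sum_(j < N.+1) (l / (nu - eps))%:E)%E).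
  exact: lee_sum.
rewrite sumEFin lee_fin sumr_const card_ord -mulr_natl mulrA /l mulrCA divff// mulr1.
by [].
Qed.

(** Exhaust Y by the sets B n, and these by compact sets. *)
Lemma measure_expansion w (B : (set R)^nat) (del : nat -> R) (eps nu a b : R) Y :
  measurable_fun setT w -> 0 <= eps -> eps < nu -> (forall n, 0 < del n) -> a < b ->
  (forall n, measurable (B n)) -> nondecreasing_seq B ->
  (forall n x y, B n x -> B n y -> `|x - y| < del n ->
    `|w x - w y| <= eps * `|x - y|) ->
  measurable Y -> Y `<=` \bigcup_n B n ->
  (forall x y, Y x -> Y y -> w x - nu * x = w y - nu * y -> x = y) ->
  (forall x, Y x -> a <= w x - nu * x <= b) ->
  (mu Y <= ((b - a) / (nu - eps))%:E)%E.
Proof.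
move=> mw eps0 epsnu del0 ab mB ndB wlip mY YB vinj vab.
have YE : Y = \bigcup_n (Y `&` B n).
  by rewrite -setI_bigcupr; apply/esym/setIidPl.
have mU : measurable (\bigcup_n (Y `&` B n)) by move: mY; rewrite {1}YE.
have cvg : (fun n => mu (Y `&` B n)) @ \oo --> mu Y.
  rewrite [in mu Y]YE; apply: nondecreasing_cvg_mu.
  - by move=> n; exact: (measurableI _ _ mY (mB n)).
  - exact: mU.
  - by move=> n m nm; apply/subsetPset; apply: setIS; exact/subsetPset/ndB.
rewrite -(cvg_lim _ cvg)//; apply: lime_le; first by apply/cvg_ex; exists (mu Y).
apply: nearW => n.
rewrite lebesgue_regularity_inner_sup; last exact: (measurableI _ _ mY (mB n)).
apply: ge_ereal_sup => _ [K [cK KYB] <-].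
apply: (@compact_expansion w K eps (del n)) => //.
- by move=> x y /KYB[_ Bx] /KYB[_ By]; exact: wlip.
- by move=> x y /KYB[Yx _] /KYB[Yy _]; exact: vinj.
- by move=> x /KYB[Yx _]; exact: vab.
Qed.

End expansion.

(** * Points seen with a prescribed slope *)

Section lower_bounds.
Context {R : realType}.

Lemma ge0_integral_ge_cst_on d (T : measurableType d)
    (m : {measure set T -> \bar R}) (A : set T) (f : T -> \bar R) (c : R) :
  measurable A -> measurable_fun A f -> 0 <= c ->
  (forall x, A x -> (c%:E <= f x)%E) -> (c%:E * m A <= \int[m]_(x in A) f x)%E.
Proof.
move=> mA mf c0 cf; rewrite -integral_cst//; exact: ge0_le_integral.
Qed.

Lemma ge0_integral_ge_cst d (T : measurableType d)
    (m : {measure set T -> \bar R}) (A : set T) (f : T -> \bar R) (c : R) :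
  measurable A -> measurable_fun setT f -> (forall x, 0 <= f x)%E -> 0 <= c ->
  (forall x, A x -> (c%:E <= f x)%E) -> (c%:E * m A <= \int[m]_x f x)%E.
Proof.
move=> mA mf f0 c0 cf.
apply: le_trans (ge0_integral_ge_cst_on m mA (measurable_funTS mf) c0 cf) _.
exact: ge0_subset_integral.
Qed.

Lemma near_natSinv_lt (e : R) : 0 < e -> \forall k \near \oo, k.+1%:R^-1 < e.
Proof. by move=> e0; exact: (near_infty_natSinv_lt (PosNum e0)). Qed.

End lower_bounds.

Section excess.
Context {R : realType}.
Local Notation mu := (@lebesgue_measure R).

(** If the points X seen with slope nu were too few, the remaining good points
would be mapped injectively by x |-> w x - nu x into the interval [w b - c/8 -
nu b, w a + c/8 - nu a], with c = w b - w a, which is shorter than nu (b - a)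
by 3 c / 4; this contradicts [measure_expansion]. The values leave this
interval only for x within r = 2 M / nu of an endpoint, and there w must
differ from its value at the endpoint by c/8. The last two hypotheses, a form
of approximate continuity at a and b, say that few points do so. The threshold
for nu makes r smaller than r0 and eps negligible. *)
Lemma excess_measure (w : R -> R) (B : (set R)^nat) (del : nat -> R)
    (eps M a b r0 : R) :
  measurable_fun setT w -> 0 <= eps -> (forall n, 0 < del n) -> a < b ->
  (forall n, measurable (B n)) -> nondecreasing_seq B ->
  (forall n x y, B n x -> B n y -> `|x - y| < del n ->
    `|w x - w y| <= eps * `|x - y|) ->
  mu (`]a, b[%classic `\` \bigcup_n B n) = 0%E ->
  0 < M -> (forall x, a <= x <= b -> `|w x| <= M) ->
  w a < w b -> eps * (b - a) <= (w b - w a) / 8 ->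
  0 < r0 ->
  (forall r, 0 < r < r0 ->
    (mu (`]a, (a + r)%R[%classic `&` [set x | (w a + (w b - w a) / 8 < w x)%R]) <=
       ((w b - w a) / (32 * M) * r)%:E)%E) ->
  (forall r, 0 < r < r0 ->
    (mu (`](b - r)%R, b[%classic `&` [set x | (w x < w b - (w b - w a) / 8)%R]) <=
       ((w b - w a) / (32 * M) * r)%:E)%E) ->
  exists2 nu0, 1 <= nu0 & forall nu, nu0 <= nu -> forall X, measurable X ->
    (forall x y, `]a, b[%classic x -> `]a, b[%classic y ->
       (\bigcup_n B n) x -> (\bigcup_n B n) y -> x <> y ->
       w x - nu * x = w y - nu * y -> X x) ->
    (((w b - w a) / (2 * nu))%:E <= mu (X `&` `]a, b[%classic))%E.
Proof.
move=> mw eps0 del0 ab mB ndB wlip nullB M0 wM wab epsab r00 Ha Hb.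
set c := w b - w a in epsab Ha Hb *.
have c0 : 0 < c by rewrite subr_gt0.
pose D := b - a; have D0 : 0 < D by rewrite subr_gt0.
exists (1 + eps + c / D + 2 * M / r0 + 2 * M / r0).
  by rewrite -!addrA lerDl !addr_ge0// ltW// divr_gt0// mulr_gt0.
move=> nu nu_ge X mX Xinj.
have cD0 : 0 < c / D by rewrite divr_gt0.
have Mr0 : 0 < 2 * M / r0 by rewrite divr_gt0// mulr_gt0.
have nu1 : 1 < nu by lra.
have nu0 : 0 < nu by lra.
have epsnu : eps < nu by lra.
have cnu : c < nu * D by rewrite -ltr_pdivrMr//; lra.
pose r := 2 * M / nu.
have r_gt0 : 0 < r by rewrite divr_gt0// mulr_gt0.
have rr0 : r < r0 by rewrite ltr_pdivrMr// [r0 * nu]mulrC -ltr_pdivrMr//; lra.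
have nur : nu * r = 2 * M by rewrite /r mulrC divfK// gt_eqF.
have r0r : 0 < r < r0 by rewrite r_gt0.
pose I : set R := `]a, b[%classic.
pose Za := `]a, (a + r)%R[%classic `&` [set x | (w a + c / 8 < w x)%R].
pose Zb := `](b - r)%R, b[%classic `&` [set x | (w x < w b - c / 8)%R].
have mI : measurable I by exact: measurable_itv.
have mZa : measurable Za.
  apply: measurableI; first exact: measurable_itv.
  rewrite (_ : [set _ | _] = w @^-1` `]w a + c / 8, +oo[%classic); last first.
    by apply/seteqP; split => x /=; rewrite in_itv/= andbT.
  by rewrite -[X in measurable X]setTI; exact: mw.
have mZb : measurable Zb.
  apply: measurableI; first exact: measurable_itv.
  rewrite (_ : [set _ | _] = w @^-1` `]-oo, w b - c / 8[%classic); last first.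
    by apply/seteqP; split => x /=; rewrite in_itv.
  by rewrite -[X in measurable X]setTI; exact: mw.
have mUB : measurable (\bigcup_n B n) by exact: bigcupT_measurable.
pose Y := (((I `&` \bigcup_n B n) `\` X) `\` Za) `\` Zb.
have mY : measurable Y.
  by do 3 apply: measurableD => //; exact: measurableI.
pose al := w b - c / 8 - nu * b.
pose be := w a + c / 8 - nu * a.
(* the deficit 3 c / 4 is what contradicts an expansion by nearly nu *)
have abE : be - al = nu * D - 3 * c / 4 by rewrite /be /al /D /c; field.
have al_be : al < be by rewrite -subr_gt0 abE; lra.
have Ybound : (mu Y <= ((be - al) / (nu - eps))%:E)%E.
  apply: (@measure_expansion R w B del) => //.
  - by move=> x [[[[_ Bx] _] _] _].
  - move=> x y [[[[Ix Bx] nXx] _] _] [[[[Iy By] nXy] _] _] vxy.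
    by apply: contrapT => xy; apply: nXx; exact: (Xinj x y).
  - move=> x [[[[Ix _] _] nZa] nZb].
    move: (Ix); rewrite /I/= in_itv/= => /andP[ax xb].
    have wx : `|w x| <= M by apply: wM; rewrite !ltW.
    have wa : `|w a| <= M by apply: wM; rewrite lexx ltW.
    have wb : `|w b| <= M by apply: wM; rewrite lexx ltW.
    move: wx wa wb; rewrite !ler_norml => /andP[wx1 wx2] /andP[wa1 wa2] /andP[wb1 wb2].
    have nuax : nu * a < nu * x by rewrite ltr_pM2l.
    have nuxb : nu * x < nu * b by rewrite ltr_pM2l.
    apply/andP; split.
      have [xbr|xbr] := ltP (b - r) x.
        have : w b - c / 8 <= w x.
          rewrite leNgt; apply/negP => h; apply: nZb; split => //=.
          by rewrite in_itv/= xbr xb.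
        by rewrite /al; lra.
      have : nu * x <= nu * b - 2 * M.
        by rewrite -nur -mulrBr ler_pM2l.
      by rewrite /al; lra.
    have [xar|xar] := ltP x (a + r).
      have : w x <= w a + c / 8.
        rewrite leNgt; apply/negP => h; apply: nZa; split => //=.
        by rewrite in_itv/= xar ax.
      by rewrite /be; lra.
    have : nu * a + 2 * M <= nu * x by rewrite -nur -mulrDr ler_pM2l.
    by rewrite /be; lra.
have Isub : I `<=` (Y `|` (X `&` I)) `|` (Za `|` Zb) `|` (I `\` \bigcup_n B n).
  move=> x Ix.
  have [Bx|nB] := pselect ((\bigcup_n B n) x); last by right.
  left.
  have [Xx|nX] := pselect (X x); first by left; right.
  have [Za_|nZa] := pselect (Za x); first by right; left.
  have [Zb_|nZb] := pselect (Zb x); first by right; right.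
  by left; left.
have muI : mu I = D%:E by rewrite /I lebesgue_measure_itv/= lte_fin ab EFinB.
have mXI : measurable (X `&` I) by exact: measurableI.
have : (D%:E <= mu Y + mu (X `&` I) + (mu Za + mu Zb) + 0)%E.
  rewrite -muI -nullB.
  have mD_ : measurable (I `\` \bigcup_n B n) by exact: measurableD.
  have mZ : measurable (Za `|` Zb) by exact: measurableU.
  have mYX : measurable (Y `|` (X `&` I)) by exact: measurableU.
  have mYXZ : measurable ((Y `|` (X `&` I)) `|` (Za `|` Zb)) by exact: measurableU.
  apply: (@le_trans _ _ (mu ((Y `|` (X `&` I)) `|` (Za `|` Zb) `|` (I `\` \bigcup_n B n)))).
    by apply: le_measure; rewrite ?inE//; exact: measurableU.
  apply: le_trans (measureU2 _ _ _) _ => //; apply: leeD => //.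
  apply: le_trans (measureU2 _ _ _) _ => //; apply: leeD => //.
    exact: measureU2.
  exact: measureU2.
have fXI : mu (X `&` I) \is a fin_num.
  rewrite ge0_fin_numE//; apply: (@le_lt_trans _ _ (mu I)).
    by apply: le_measure; rewrite ?inE//; exact: subIsetr.
  by rewrite muI ltry.
have fY : mu Y \is a fin_num.
  by rewrite ge0_fin_numE//; apply: (le_lt_trans Ybound); rewrite ltry.
have Za_le := Ha r r0r; have Zb_le := Hb r r0r.
have fZa : mu Za \is a fin_num.
  by rewrite ge0_fin_numE//; apply: (le_lt_trans Za_le); rewrite ltry.
have fZb : mu Zb \is a fin_num.
  by rewrite ge0_fin_numE//; apply: (le_lt_trans Zb_le); rewrite ltry.
rewrite -/I adde0 -(fineK fXI) -(fineK fY) -(fineK fZa) -(fineK fZb).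
rewrite -(fineK fY) in Ybound.
rewrite -/Za -(fineK fZa) lee_fin in Za_le.
rewrite -/Zb -(fineK fZb) lee_fin in Zb_le.
rewrite !lee_fin in Ybound *.
have rE : c / (32 * M) * r = c / (16 * nu).
  by rewrite /r; field; rewrite !gt_eqF.
rewrite rE in Za_le Zb_le.
have : (be - al) / (nu - eps) <= D - 5 * c / (8 * nu).
  rewrite ler_pdivrMr ?subr_gt0// abE.
  have -> : (D - 5 * c / (8 * nu)) * (nu - eps) =
     nu * D - 5 * c / 8 - eps * D + eps * (5 * c / (8 * nu)).
    by field; rewrite gt_eqF.
  have : 0 <= eps * (5 * c / (8 * nu)).
    by rewrite mulr_ge0// divr_ge0// ?mulr_ge0// ltW.
  by move: epsab; rewrite -/D; lra.
have e1 : 5 * c / (8 * nu) = c / (2 * nu) + (c / (16 * nu) + c / (16 * nu)).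
  by field; rewrite gt_eqF.
by rewrite e1; move: Za_le Zb_le Ybound; lra.
Qed.

End excess.

(** * Lower bound for the density of slopes *)

Section line_energy.
Context {R : realType}.
Local Notation mu := (@lebesgue_measure R).

Definition quotient (w : R -> R) (z : measurableTypeR R * measurableTypeR R) : R :=
  (w z.2 - w z.1) / (z.2 - z.1).

(** Division by zero makes this vanish on the diagonal. *)
Definition line_kernel (om w : R -> R) (S : set R)
    (z : measurableTypeR R * measurableTypeR R) : \bar R :=
  (om `|quotient w z| / `|z.2 - z.1| * (\1_S z.1 * \1_S z.2))%:E.

Variables (om w : R -> R) (S : set R).
Hypotheses (om0 : forall x, 0 <= om x) (com : continuous om).
Hypotheses (mw : measurable_fun setT w) (mS : measurable S).

Lemma measurable_invr : measurable_fun setT (@GRing.inv R).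
Proof.
rewrite (_ : [set: R] = [set x | x != 0] `|` [set 0]); last first.
  by apply/seteqP; split => // x _ /=; case: (eqVneq x 0); [right|left].
apply/measurable_funU.
- by apply: open_measurable; exact: open_neq.
- exact: measurable_set1.
split; last exact: measurable_fun_set1.
apply: open_continuous_measurable_fun; first exact: open_neq.
by move=> x; rewrite inE /= => x0; exact: inv_continuous.
Qed.

Lemma measurable_quotient : measurable_fun setT (quotient w).
Proof.
apply: measurable_funM.
  apply: measurable_funB.
    exact: (measurableT_comp mw measurable_snd).
  exact: (measurableT_comp mw measurable_fst).
apply: (measurableT_comp measurable_invr).
by apply: measurable_funB.
Qed.

Lemma measurable_line_kernel : measurable_fun setT (line_kernel om w S).
Proof.
apply/measurable_EFinP; apply: measurable_funM; last first.
  apply: measurable_funM.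
    by apply: (measurableT_comp _ measurable_fst); exact: measurable_indic.
  by apply: (measurableT_comp _ measurable_snd); exact: measurable_indic.
apply: measurable_funM.
  apply: (measurableT_comp (continuous_measurable_fun com)).
  by apply: measurableT_comp => //; exact: measurable_quotient.
apply: (measurableT_comp measurable_invr).
by apply: measurableT_comp => //; exact: measurable_funB.
Qed.

Lemma line_kernel_ge0 z : (0 <= line_kernel om w S z)%E.
Proof. by rewrite lee_fin !mulr_ge0// invr_ge0. Qed.

(** On B, near y0, the function w moves by at most nu |y - y0|, so the slope
seen from x stays within h of nu as long as y belongs to B and |y - y0| < h t,
where t = |y0 - x| / (4 nu). These y have measure at least h t, the kernel is
there at least om(nu) / (4 |y0 - x|), and the average over the window divides
by 2 h; the factors h and |y0 - x| cancel. *)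
Lemma slice_density_ge (B : set R) (x y0 nu del rho0 r : R) :
  measurable B -> S x -> x != y0 -> 0 < nu -> quotient w (x, y0) = nu ->
  0 < del -> (forall y, B y -> `|y - y0| < del -> `|w y - w y0| <= nu * `|y - y0|) ->
  0 < r -> ball y0 r `<=` S ->
  0 < rho0 -> (forall rho, 0 < rho < rho0 -> (rho%:E <= mu (B `&` ball y0 rho))%E) ->
  0 < om nu ->
  ((om nu / (32 * nu))%:E <=
    slice_density mu (line_kernel om w S) (quotient w) nu x)%E.
Proof.
move=> mB Sx xy0 nu0 qnu del0 wlip r0 ballS rho00 dens omnu0.
pose D := `|y0 - x|.
have D0 : 0 < D by rewrite normr_gt0 subr_eq0 eq_sym.
have [e e0 He] : exists2 e, 0 < e & forall m, `|m - nu| < e -> om nu / 2 <= om m.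
  have /cvgrPdist_lt/(_ (om nu / 2)) := @com nu.
  rewrite divr_gt0// => /(_ isT) /nbhs_ballP[e /= e0 He].
  exists e => // m mnu.
  have := He m; rewrite /ball/= distrC => /(_ mnu).
  by rewrite ltr_norml => /andP[_]; lra.
pose t := D / (4 * nu).
have t0 : 0 < t by rewrite divr_gt0// mulr_gt0.
have [N _ HN] : \forall k \near \oo, [/\ k.+1%:R^-1 < e, k.+1%:R^-1 < nu,
    k.+1%:R^-1 * t < rho0, k.+1%:R^-1 * t < del & k.+1%:R^-1 * t < r].
  near=> k; split; rewrite -?ltr_pdivlMr//; near: k; apply: near_natSinv_lt => //;
    by rewrite divr_gt0.
apply: (@limn_einf_ge _ _ _ N) => k Nk; have [he hnu hrho0 hdel hr] := HN k Nk.
set h : R := k.+1%:R^-1 in he hnu hrho0 hdel hr.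
have h0 : 0 < h by rewrite invr_gt0.
have rho_gt0 : 0 < h * t by rewrite mulr_gt0.
have htD : h * t < D / 4.
  rewrite /t mulrA ltr_pdivrMr ?mulr_gt0// mulrC.
  have -> : D / 4 * (4 * nu) = D * nu by field.
  by rewrite ltr_pM2l.
have mA : measurable (B `&` ball y0 (h * t)).
  by apply: measurableI => //; exact: measurable_ball.
have : (((om nu / (32 * nu)) / (h * t))%:E * mu (B `&` ball y0 (h * t)) <=
  window_avg mu (line_kernel om w S) (quotient w) k nu x)%E.
  apply: ge0_integral_ge_cst => //.
  - exact: (measurable_window_section measurable_line_kernel measurable_quotient).
  - by move=> y; rewrite mule_ge0 ?line_kernel_ge0// lee_fin mulr_ge0.
  - by rewrite divr_ge0 ?(ltW rho_gt0)// divr_ge0 ?ltW// mulr_gt0.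
  move=> y [By]; rewrite /ball/= distrC => yy0.
  have Sy : S y by apply: ballS; rewrite /ball/= distrC; exact: lt_trans hr.
  have wy := wlip _ By (lt_trans yy0 hdel).
  have yx_ge : D / 2 <= `|y - x|.
    have := ler_distD y y0 x; rewrite -/D [`|y0 - y|]distrC; move: yy0 htD.
    by have := D0; lra.
  have yx_le : `|y - x| <= 2 * D.
    have := ler_distD y0 y x; rewrite -/D; move: yy0 htD.
    by have := D0; lra.
  have yx0 : 0 < `|y - x| by apply: lt_le_trans yx_ge; rewrite divr_gt0.
  have yxn0 : y - x != 0 by rewrite -normr_gt0.
  have qh : `|quotient w (x, y) - nu| < h.
    have -> : quotient w (x, y) - nu =
        ((w y - w y0) - nu * (y - y0)) / (y - x).
      have wE : w y0 - w x = nu * (y0 - x).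
        by rewrite -qnu /quotient /= divfK// subr_eq0 eq_sym.
      have {}wE : w y0 = w x + nu * (y0 - x) by rewrite -wE; ring.
      have -> : w y - w y0 - nu * (y - y0) = (w y - w x) - nu * (y - x).
        by rewrite wE; ring.
      by rewrite mulrBl mulfK.
    rewrite normrM normfV ltr_pdivrMr//.
    apply: le_lt_trans (ler_normB _ _) _.
    rewrite normrM (gtr0_norm nu0).
    apply: (@lt_le_trans _ _ (2 * nu * (h * t))).
      have : nu * `|y - y0| < nu * (h * t) by rewrite ltr_pM2l.
      by lra.
    rewrite /t (_ : _ * _ = h * (D / 2)); last by field; rewrite gt_eqF.
    by rewrite ler_pM2l.
  have q0 : 0 < quotient w (x, y).
    by move: qh; rewrite ltr_norml => /andP[]; lra.
  rewrite /line_kernel /= !indicE !mem_set//= !mulr1 -EFinM lee_fin.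
  rewrite (gtr0_norm q0).
  have om_ge : om nu / 2 <= om (quotient w (x, y)) by apply: He; exact: lt_trans he.
  have inv_ge : (2 * D)^-1 <= `|y - x|^-1 by rewrite lef_pV2// posrE mulr_gt0.
  have -> : k.+1%:R = h^-1 :> R by rewrite /h invrK.
  have -> : om nu / (32 * nu) / (h * t) = (om nu / 2) * (2 * D)^-1 * (h^-1 / 2).
    by rewrite /t; field; rewrite !gt_eqF.
  rewrite ler_wpM2r ?divr_ge0 ?invr_ge0 ?(ltW h0)//.
  by rewrite ler_pM// ?invr_ge0 ?mulr_ge0 ?divr_ge0// ltW.
apply: le_trans.
have : ((h * t)%:E <= mu (B `&` ball y0 (h * t)))%E by apply: dens; rewrite rho_gt0.
move=> /(lee_wpmul2l (_ : 0 <= (om nu / (32 * nu) / (h * t))%:E)%E) => /(_ _).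
move=> H; apply: le_trans (H _); last first.
  by rewrite lee_fin divr_ge0 ?(ltW rho_gt0)// divr_ge0 ?ltW// mulr_gt0.
rewrite -EFinM lee_fin divfK ?gt_eqF//.
Unshelve. all: by end_near. Qed.

End line_energy.

(** * Bounded functions of finite energy on an interval *)

Section density.
Context {R : realType}.
Local Notation mu := (@lebesgue_measure R).

Definition density_point (A : set R) (x : R) : Prop :=
  (mu (A `&` ball x r) * (mu (ball x r))^-1)%E @[r --> 0^'+] --> 1%E.

Lemma density_pointP (A : set R) (x eta : R) : measurable A ->
  density_point A x -> 0 < eta ->
  exists2 r0, 0 < r0 & forall r, 0 < r < r0 ->
    (mu (ball x r `\` A) <= (eta * r)%:E)%E /\
    (((2 - eta) * r)%:E <= mu (A `&` ball x r))%E.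
Proof.
move=> mA dens eta0.
have e2 : (((1 - eta / 2)%:E : \bar R) < 1)%E.
  by rewrite lte_fin ltrBlDr ltrDl divr_gt0.
have := dens [set y : \bar R | ((1 - eta / 2)%:E < y)%E].
case; first exact: (@open_ereal_gt' R 1%E _ e2).
move=> r0 /= r00 H.
exists r0 => // r /andP[rgt rlt].
have := H r; rewrite /ball_/= sub0r normrN gtr0_norm// => /(_ rlt rgt).
have mb : mu (ball x r) = (r *+ 2)%:E by apply: lebesgue_measure_ball; exact: ltW.
have mball : measurable (ball x r : set (measurableTypeR R)).
  exact: measurable_ball.
have mAb : measurable (A `&` ball x r) by exact: measurableI.
have fA : mu (A `&` ball x r) \is a fin_num.
  rewrite ge0_fin_numE//; apply: (@le_lt_trans _ _ (mu (ball x r))).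
    by apply: le_measure; rewrite ?inE//; exact: subIsetr.
  by rewrite mb ltry.
have r2 : 0 < r *+ 2 by rewrite mulrn_wgt0.
rewrite mb inver gt_eqF// -(fineK fA) -EFinM lte_fin ltr_pdivlMr//.
have -> : (1 - eta / 2) * (r *+ 2) = (2 - eta) * r by rewrite -mulr_natr; field.
move=> h; split; last by rewrite lee_fin ltW.
have fb : (mu (ball x r) < +oo)%E by rewrite mb ltry.
have -> : mu (ball x r `\` A) = ((r *+ 2)%:E - mu (A `&` ball x r))%E.
  by rewrite -mb [in RHS]setIC; exact: measureD.
rewrite -(fineK fA) -EFinB lee_fin mulr2n.
by lra.
Qed.

Lemma tail_integral_infinite (om : R -> R) (nu0 : R) :
  (forall x, 0 <= om x) -> continuous om -> 1 <= nu0 ->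
  (\int[mu]_(m in `[1%R, +oo[) (om m / m ^+ 2)%:E = +oo)%E ->
  (\int[mu]_(m in `[nu0, +oo[) (om m / m ^+ 2)%:E = +oo)%E.
Proof.
move=> om0 com nu1.
have mf : measurable_fun [set: R] (fun m => om m / m ^+ 2).
  apply: measurable_funM; first exact: continuous_measurable_fun.
  by apply: (measurableT_comp measurable_invr); exact: measurable_funX.
have -> : `[1%R, +oo[%classic = `[1, nu0[%classic `|` `[nu0, +oo[%classic.
  apply/seteqP; split => x /=; rewrite !in_itv/= ?andbT.
    by move=> x1; case: (ltP x nu0); [left; rewrite x1|right].
  by move=> [/andP[]//|]; exact: le_trans.
rewrite ge0_integral_setU//=.
- move=> h; apply: contrapT => h2; move: h.
  suff : (\int[mu]_(x in `[1%R, nu0[) (om x / x ^+ 2)%:E +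
     \int[mu]_(x in `[nu0, +oo[) (om x / x ^+ 2)%:E < +oo)%E.
    by move=> /lt_eqF /eqP.
  apply: lte_add_pinfty; last by rewrite ltey; exact/eqP.
  have : mu.-integrable `[1, nu0]%classic (EFin \o (fun m => om m / m ^+ 2)).
    apply: continuous_compact_integrable; first exact: segment_compact.
    apply: continuous_in_subspaceT => x; rewrite inE/= in_itv/= => /andP[x1 _].
    apply: cvgM; first exact: com.
    apply: cvgV; last by apply: exprn_continuous.
    by rewrite expf_neq0// gt_eqF// (lt_le_trans ltr01).
  move=> /integrableP[_].
  apply: le_lt_trans.
  under [leRHS]eq_integral => x _.
    rewrite /= ger0_norm; last by rewrite divr_ge0// sqr_ge0.
    over.
  apply: ge0_subset_integral => //=.
  - by apply/measurable_EFinP; exact: measurable_funTS.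
  - by move=> x _; rewrite lee_fin divr_ge0// sqr_ge0.
  - by apply: subset_itvl; rewrite bnd_simp.
- by apply/measurable_EFinP; exact: measurable_funTS.
- by move=> x _; rewrite lee_fin divr_ge0// sqr_ge0.
- apply/disj_setPS => x [] /=; rewrite !in_itv/= => /andP[_ xl].
  by rewrite andbT leNgt xl.
Qed.

End density.

Section line_jump.
Context {R : realType}.
Local Notation mu := (@lebesgue_measure R).
Variables (om : R -> R).
Hypotheses (om0 : forall x, 0 <= om x) (com : continuous om).
Hypothesis om_gt0 : forall x, 0 < x -> 0 < om x.
Hypothesis om_int : (\int[mu]_(m in `[1%R, +oo[) (om m / m ^+ 2)%:E = +oo)%E.

Lemma density_point_ae (B : (set R)^nat) : (forall n, measurable (B n)) ->
  {ae mu, forall x, forall n, B n x -> density_point (B n) x}.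
Proof.
move=> mB; apply: ae_foralln => n.
apply: (@filterS _ _ (ae_filter_ringOfSetsType mu) _ _ _ (lebesgue_density (mB n))).
move=> x h Bx; move: h.
by rewrite indicE mem_set.
Qed.

(** The set X nu of the points x where [slice_density] is at least om nu / (32
nu) contains, by [slice_density_ge], every point from which another good point
is seen with slope nu. So [excess_measure] gives |X nu| >= c / (2 nu), and
[fatou_window] bounds the energy below by the integral of c om nu / (64 nu^2)
over the large nu. *)
Lemma line_energy_jump (w : R -> R) (S : set R) (B : (set R)^nat)
    (del : nat -> R) (eps M a b : R) (na nb : nat) :
  measurable_fun setT w -> measurable S -> 0 <= eps -> eps <= 1 ->
  (forall n, 0 < del n) -> a < b -> (forall x, a <= x <= b -> S x) ->
  (forall n, measurable (B n)) -> nondecreasing_seq B ->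
  (forall n x y, B n x -> B n y -> `|x - y| < del n ->
    `|w x - w y| <= eps * `|x - y|) ->
  mu (`]a, b[%classic `\` \bigcup_n B n) = 0%E ->
  0 < M -> (forall x, S x -> `|w x| <= M) ->
  w a < w b -> eps * (b - a) <= (w b - w a) / 8 ->
  B na a -> density_point (B na) a -> B nb b -> density_point (B nb) b ->
  (\int[mu]_x \int[mu]_y line_kernel om w S (x, y) = +oo)%E.
Proof.
move=> mw mS eps0 eps1 del0 ab abS mB ndB wlip nullB M0 wM wab epsab Ba da Bb db.
set c := w b - w a in epsab.
have c0 : 0 < c by rewrite subr_gt0.
have [N [mN N0 HN]] := density_point_ae mB.
have {}HN x n : ~ N x -> B n x -> density_point (B n) x.
  by move=> Nx Bx; apply: contrapT => h; apply: Nx; apply: HN => /= /(_ n Bx).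
have eta0 : 0 < c / (32 * M) by rewrite divr_gt0// mulr_gt0.
have [ra ra0 Ha] := density_pointP (mB na) da eta0.
have [rb rb0 Hb] := density_pointP (mB nb) db eta0.
(* below r0 the density estimates at a and b hold, and they concern points at
   small scale, between a and b *)
pose r0 := Num.min (Num.min ra rb) (Num.min (Num.min (del na) (del nb)) (b - a)).
have r00 : 0 < r0 by rewrite !lt_min ra0 rb0 !del0 subr_gt0.
pose D n := B n `\` N.
have mD n : measurable (D n) by exact: measurableD.
have UD : \bigcup_n D n = (\bigcup_n B n) `\` N by rewrite /D -setD_bigcupl.
have mUB : measurable (\bigcup_n B n) by exact: bigcupT_measurable.
have mI : measurable (`]a, b[%classic : set R) by exact: measurable_itv.
have jumpsmall (s t : R) (n : nat) r : B n s -> r <= del n -> r <= b - a ->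
    `|t - s| < r -> c / 8 < `|w t - w s| -> (ball s r `\` B n) t.
  move=> Bs rd rba tsr jump; split; first by rewrite /ball/= distrC.
  move=> Bt; move: jump; rewrite ltNge => /negP; apply.
  apply: le_trans (wlip n _ _ Bt Bs (lt_le_trans tsr rd)) _.
  by apply: le_trans epsab; rewrite ler_wpM2l// (le_trans (ltW tsr)).
have [nu0 nu01 Hnu] : exists2 nu0, 1 <= nu0 & forall nu, nu0 <= nu ->
    forall X, measurable X ->
    (forall x y, `]a, b[%classic x -> `]a, b[%classic y ->
       (\bigcup_n D n) x -> (\bigcup_n D n) y -> x <> y ->
       w x - nu * x = w y - nu * y -> X x) ->
    ((c / (2 * nu))%:E <= mu (X `&` `]a, b[%classic))%E.
  apply: (@excess_measure R w D del eps M a b r0) => //.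
  - by move=> n m nm; apply/subsetPset; apply: setSD; exact/subsetPset/ndB.
  - by move=> n x y [Bx _] [By _]; exact: wlip.
  - apply/eqP; rewrite eq_le measure_ge0 andbT.
    apply: (@le_trans _ _ (mu ((`]a, b[%classic `\` \bigcup_n B n) `|` N))).
      apply: le_measure; rewrite ?inE.
      + by apply: measurableD => //; rewrite UD; exact: measurableD.
      + by apply: measurableU => //; exact: measurableD.
      + move=> x [Ix]; rewrite UD => nBN.
        have [Nx|nNx] := pselect (N x); first by right.
        by left; split => // Bx; exact: nBN.
    have -> : 0%E = (mu (`]a, b[%classic `\` \bigcup_n B n) + mu N)%E :> \bar R.
      by rewrite nullB N0 adde0.
    by apply: measureU2 => //; exact: measurableD.
  - by move=> x xab; apply: wM; exact: abS.
  - move=> r /andP[rgt]; rewrite !lt_min -!andbA => /and5P[rra rrb rda rdb rba].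
    have [h _] := Ha r (introT andP (conj rgt rra)).
    apply: le_trans h; apply: le_measure; rewrite ?inE.
    + apply: measurableI; first exact: measurable_itv.
      rewrite (_ : [set _ | _] = w @^-1` `]w a + c / 8, +oo[%classic).
        by rewrite -[X in measurable X]setTI; exact: mw.
      by apply/seteqP; split => x /=; rewrite in_itv/= andbT.
    + exact: (measurableD (measurable_ball _ _) (mB _)).
    move=> x [] /=; rewrite in_itv/= => /andP[ax xar] wax.
    apply: jumpsmall => //; [exact: ltW|exact: ltW| |].
      by rewrite gtr0_norm ?subr_gt0 ?ltrBlDl.
    by apply: lt_le_trans (ler_norm _); rewrite ltrBrDl.
  - move=> r /andP[rgt]; rewrite !lt_min -!andbA => /and5P[rra rrb rda rdb rba].
    have [h _] := Hb r (introT andP (conj rgt rrb)).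
    apply: le_trans h; apply: le_measure; rewrite ?inE.
    + apply: measurableI; first exact: measurable_itv.
      rewrite (_ : [set _ | _] = w @^-1` `]-oo, w b - c / 8[%classic).
        by rewrite -[X in measurable X]setTI; exact: mw.
      by apply/seteqP; split => x /=; rewrite in_itv/=.
    + exact: (measurableD (measurable_ball _ _) (mB _)).
    move=> x [] /=; rewrite in_itv/= => /andP[bx xb] wxb.
    apply: jumpsmall => //; [exact: ltW|exact: ltW| |].
      by rewrite distrC gtr0_norm ?subr_gt0// ltrBlDr -ltrBlDl.
    by rewrite distrC; apply: lt_le_trans (ler_norm _); rewrite ltrBrDr -ltrBrDl.
pose X nu := [set x | ((om nu / (32 * nu))%:E <=
    slice_density mu (line_kernel om w S) (quotient w) nu x)%E].
have mK : measurable_fun setT (line_kernel om w S).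
  exact: (measurable_line_kernel com mw mS).
have K0 z : (0 <= line_kernel om w S z)%E by exact: line_kernel_ge0.
have mq := measurable_quotient mw.
pose F (p : measurableTypeR R * measurableTypeR R) :=
  slice_density mu (line_kernel om w S) (quotient w) p.1 p.2.
have mslice : measurable_fun setT F.
  exact: measurable_slice_density.
have mslice1 nu : measurable_fun setT (fun x : measurableTypeR R => F (nu, x)).
  exact: (measurableT_comp mslice (measurable_pair1 nu)).
have mX nu : measurable (X nu).
  rewrite /X -[X in measurable X]setTI.
  exact: (emeasurable_fun_c_infty measurableT (mslice1 nu)).
have S0 nu x : (0 <= slice_density mu (line_kernel om w S) (quotient w) nu x)%E.
  exact: slice_density_ge0.
have mF : measurable_fun [set: measurableTypeR R] (fun nu => \int[mu]_x
    slice_density mu (line_kernel om w S) (quotient w) nu x)%E.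
  apply: (measurable_fun_fubini_tonelli_F (m2 := mu) F mslice).
  by move=> p; exact: slice_density_ge0.
have F0 nu : (0 <= \int[mu]_x slice_density mu (line_kernel om w S) (quotient w) nu x)%E.
  exact: integral_ge0.
have Xge nu : nu0 <= nu -> ((c / (2 * nu))%:E <= mu (X nu `&` `]a, b[%classic))%E.
  move=> nu_ge; apply: (Hnu nu nu_ge (X nu) (mX nu)) => x y Ix Iy [n1 _ [Bx Nx]] [n2 _ [By Ny]] xy vxy.
  have nu1 : 1 <= nu by exact: le_trans nu_ge.
  have nu_gt0 : 0 < nu by exact: lt_le_trans nu1.
  have [rho0 rho00 Hrho] := density_pointP (mB n2) (HN _ _ Ny By) (@ltr01 R).
  move: (Ix) (Iy); rewrite /= !in_itv/= => /andP[ax xb] /andP[ay yb].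
  apply: (@slice_density_ge R om w S om0 com mw mS (B n2) x y nu (del n2) rho0
     (Num.min (y - a) (b - y))) => //.
  - by apply: abS; rewrite !ltW.
  - exact/eqP.
  - rewrite /quotient/=; have yx : y - x != 0 by rewrite subr_eq0 eq_sym; exact/eqP.
    have -> : w y - w x = nu * (y - x) by rewrite mulrBr; clear -vxy; lra.
    by rewrite mulfK.
  - move=> z Bz zy; apply: le_trans (wlip _ _ _ Bz By zy) _.
    by rewrite ler_wpM2r// (le_trans eps1).
  - by rewrite lt_min !subr_gt0 ay yb.
  - move=> z; rewrite /ball/= lt_min !ltr_distl => /andP[/andP[h1 h2] /andP[h3 h4]].
    by apply: abS; apply/andP; split; clear -h1 h2 h3 h4; lra.
  - move=> rho /Hrho[_]; rewrite (_ : 2 - 1 = 1 :> R) ?mul1r//; by ring.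
  - exact: om_gt0.
apply/eqP; rewrite -leye_eq.
apply: le_trans (fatou_window mu mu mK K0 mq).
have tail := tail_integral_infinite om0 com nu01 om_int.
have c64 : 0 < c / 64 by rewrite divr_gt0.
rewrite (_ : +oo%E = ((c / 64)%:E *
    \int[mu]_(m in `[nu0, +oo[) (om m / m ^+ 2)%:E)%E); last first.
  by rewrite tail gt0_muley// lte_fin.
rewrite -ge0_integralZl//; last 3 first.
- apply/measurable_EFinP; apply: measurable_funTS; apply: measurable_funM.
    exact: continuous_measurable_fun.
  by apply: (measurableT_comp measurable_invr); exact: measurable_funX.
- by move=> m _; rewrite lee_fin divr_ge0// sqr_ge0.
- by rewrite lee_fin ltW.
apply: (@le_trans _ _ (\int[mu]_(nu in `[nu0, +oo[) \int[mu]_x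
   slice_density mu (line_kernel om w S) (quotient w) nu x)%E).
  apply: ge0_le_integral => //=.
  - by move=> m _; rewrite -EFinM lee_fin mulr_ge0 ?(ltW c64)// divr_ge0// sqr_ge0.
  - apply/measurable_EFinP; apply: measurable_funTS.
    apply: measurable_funM => //; apply: measurable_funM.
      exact: continuous_measurable_fun.
    by apply: (measurableT_comp measurable_invr); exact: measurable_funX.
  - by apply: measurable_funTS.
  move=> nu; rewrite /= in_itv/= andbT => nu_ge.
  have nu_gt0 : 0 < nu by rewrite (lt_le_trans _ nu_ge)// (lt_le_trans _ nu01).
  have : ((om nu / (32 * nu))%:E * mu (X nu `&` `]a, b[%classic) <=
      \int[mu]_x slice_density mu (line_kernel om w S) (quotient w) nu x)%E.
    apply: (@ge0_integral_ge_cst R _ (measurableTypeR R) mu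
      (X nu `&` `]a, b[%classic) (fun x => F (nu, x))).
    - exact: (measurableI _ _ (mX nu) mI).
    - exact: mslice1.
    - exact: (S0 nu).
    - by rewrite divr_ge0// ltW// mulr_gt0.
    - by move=> x [].
  apply: le_trans.
  apply: le_trans (lee_wpmul2l _ (Xge _ nu_ge)); last first.
    by rewrite lee_fin divr_ge0// ltW// mulr_gt0.
  rewrite -!EFinM lee_fin le_eqVlt; apply/orP; left; apply/eqP; field.
  by rewrite gt_eqF.
by apply: ge0_subset_integral.
Qed.

End line_jump.

Section line_constancy.
Context {R : realType}.
Local Notation mu := (@lebesgue_measure R).
Variables (om : R -> R).
Hypotheses (om0 : forall x, 0 <= om x) (com : continuous om).
Hypothesis om_gt0 : forall x, 0 < x -> 0 < om x.
Hypothesis om_int : (\int[mu]_(m in `[1%R, +oo[) (om m / m ^+ 2)%:E = +oo)%E.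

Definition lipschitz_pieces (eps : R) (w : R -> R) (B : (set R)^nat)
    (del : nat -> R) : Prop :=
  forall n x y, B n x -> B n y -> `|x - y| < del n -> `|w x - w y| <= eps * `|x - y|.

(** The replacement for a vanishing approximate derivative almost everywhere:
contrary to a condition at each point, it is inherited by almost every slice
of a function of several variables. *)
Definition flat_on (S : set R) (w : R -> R) : Prop :=
  forall eps, 0 < eps -> exists B : (set R)^nat, exists del : nat -> R,
    [/\ forall n, measurable (B n), nondecreasing_seq B, forall n, 0 < del n,
        lipschitz_pieces eps w B del & mu (S `\` \bigcup_n B n) = 0%E].

Lemma line_kernelN w S z : line_kernel om (\- w) S z = line_kernel om w S z.
Proof.
rewrite /line_kernel /quotient; congr (om _ / _ * _)%:E.
by rewrite !normrM; congr (_ * _); rewrite /= -opprD normrN.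
Qed.

(** If w took two values at points that are density points of Lipschitz pieces
for every eps = 1/(k+1), one of these eps would be small with respect to the
jump, and [line_energy_jump] would apply to w or to - w. *)
Lemma line_energy_constant (w : R -> R) (S : set R) (M : R) :
  measurable_fun setT w -> measurable S ->
  (forall x y z, S x -> S y -> x <= z <= y -> S z) ->
  (forall x, S x -> `|w x| <= M) -> flat_on S w ->
  (\int[mu]_x \int[mu]_y line_kernel om w S (x, y) < +oo)%E ->
  exists c, mu (S `&` [set x | w x != c]) = 0%E.
Proof.
move=> mw mS itvS wM flat fin.
have eps0 k : 0 < k.+1%:R^-1 :> R by rewrite invr_gt0.
pose B k := projT1 (cid (flat _ (eps0 k))).
pose del k := projT1 (cid (projT2 (cid (flat _ (eps0 k))))).
have BP k : [/\ forall n, measurable (B k n), nondecreasing_seq (B k), forall n, 0 < del k n,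
    lipschitz_pieces k.+1%:R^-1 w (B k) (del k) & mu (S `\` \bigcup_n B k n) = 0%E].
  exact: (projT2 (cid (projT2 (cid (flat _ (eps0 k)))))).
pose good x := forall k, exists2 n, B k n x & density_point (B k n) x.
have aegood : {ae mu, forall x, S x -> good x}.
  have : {ae mu, forall x, forall k, S x -> exists2 n, B k n x & density_point (B k n) x}.
    apply: ae_foralln => k; have [mB _ _ _ S0] := BP k.
    have h1 : {ae mu, forall x, S x -> (\bigcup_n B k n) x}.
      exists (S `\` \bigcup_n B k n); split => //.
        by apply: measurableD => //; exact: bigcupT_measurable.
      by move=> x /= /not_implyP.
    have h2 := density_point_ae mB.
    apply: (@filterS2 _ _ (ae_filter_ringOfSetsType mu) _ _ _ _ h1 h2).
    by move=> x H1 H2 Sx; have [n _ Bx] := H1 Sx; exists n => //; exact: H2.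
  apply: (@filterS _ _ (ae_filter_ringOfSetsType mu)) => x h Sx k.
  exact: h.
suff const : forall s t, S s -> S t -> good s -> good t -> s < t -> w s = w t.
  have [[s [Ss gs]]|none] := pselect (exists s, S s /\ good s).
    exists (w s); apply/negligibleP.
      apply: measurableI => //.
      rewrite (_ : [set _ | _] = w @^-1` (~` [set w s])).
        by rewrite -[X in measurable X]setTI; apply: mw => //; exact: measurableC.
      by apply/seteqP; split => x /= /eqP.
    apply: negligibleS aegood => x [Sx /= wx] h.
    move: wx => /eqP; apply; have gx := h Sx.
    by have [xs|xs|->//] := ltgtP x s; [|apply/esym]; exact: const.
  exists 0; apply/negligibleP.
    apply: measurableI => //.
    rewrite (_ : [set _ | _] = w @^-1` (~` [set 0])).
      by rewrite -[X in measurable X]setTI; apply: mw => //; exact: measurableC.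
    by apply/seteqP; split => x /= /eqP.
  apply: negligibleS aegood => x [Sx /= wx] h.
  by apply: none; exists x; split => //; exact: h.
move=> s t Ss St gs gt st; apply: contrapT => /eqP wst_neq; move: wst_neq.
have M0 : 0 < `|M| + 1 by rewrite ltr_wpDl.
have key (v : R -> R) : measurable_fun setT v -> (forall x, S x -> `|v x| <= `|M| + 1) ->
    (forall k, lipschitz_pieces k.+1%:R^-1 v (B k) (del k)) -> v s < v t ->
    (\int[mu]_x \int[mu]_y line_kernel om v S (x, y) = +oo)%E.
  move=> mv vM lip vst.
  have [k _ Hk] : \forall k \near \oo, k.+1%:R^-1 < (v t - v s) / 8 / (t - s).
    by apply: near_natSinv_lt; rewrite !divr_gt0// subr_gt0.
  have {}Hk := Hk k (leqnn k).
  have [mB ndB del0 _ S0] := BP k.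
  have [n1 Bs ds] := gs k; have [n2 Bt dt] := gt k.
  apply: (@line_energy_jump R om om0 com om_gt0 om_int v S (B k) (del k)
    k.+1%:R^-1 (`|M| + 1) s t n1 n2) => //.
  - by rewrite invf_le1// ler1n.
  - by move=> x; exact: itvS.
  - exact: lip.
  - apply/eqP; rewrite eq_le measure_ge0 andbT -S0.
    apply: le_measure; rewrite ?inE.
    + by apply: measurableD; [exact: measurable_itv|exact: bigcupT_measurable].
    + by apply: measurableD => //; exact: bigcupT_measurable.
    apply: setSD => x /=; rewrite in_itv/= => /andP[sx xt].
    by apply: (itvS s t) => //; rewrite !ltW.
  - by rewrite ltW// -ltr_pdivlMr// subr_gt0.
have wM1 x : S x -> `|w x| <= `|M| + 1.
  by move=> Sx; rewrite (le_trans (wM _ Sx))// (le_trans (ler_norm _))// lerDl.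
have lipw k : lipschitz_pieces k.+1%:R^-1 w (B k) (del k).
  by have [] := BP k.
rewrite neq_lt => /orP[wst|wts].
  by move: fin; rewrite (key w mw wM1 lipw wst) ltxx.
have : (\int[mu]_x \int[mu]_y line_kernel om (\- w)%R S (x, y) = +oo)%E.
  apply: key.
  - exact: measurableT_comp.
  - by move=> x Sx; rewrite /= normrN wM1.
  - by move=> k n x y Bx By xy; rewrite /= -opprD normrN; exact: (lipw k n).
  - by rewrite /= ltrN2.
under eq_integral do under eq_integral do rewrite line_kernelN.
by move=> E; move: fin; rewrite E ltxx.
Qed.

End line_constancy.

(** * Slicing pairs of points by lines *)

Section ae_integral.
Local Open Scope ereal_scope.
Context {R : realType} d (T : measurableType d) (m : {measure set T -> \bar R}).
Variable f : T -> \bar R.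
Hypotheses (mf : measurable_fun setT f) (f0 : forall x, 0 <= f x).

Lemma ge0_integral_lty_ae : \int[m]_x f x < +oo -> {ae m, forall x, f x < +oo}.
Proof.
move=> fin.
have : m.-integrable setT f.
  apply/integrableP; split => //.
  by under eq_integral do rewrite gee0_abs//.
move=> /integrable_ae -/(_ measurableT).
apply: (@filterS _ _ (ae_filter_ringOfSetsType m)) => x /(_ I).
by rewrite ge0_fin_numE.
Qed.

Lemma ge0_integral0_ae : \int[m]_x f x = 0 <-> {ae m, forall x, f x = 0}.
Proof.
have -> : \int[m]_x f x = \int[m]_x `|f x|.
  by apply: eq_integral => x _; rewrite gee0_abs.
split=> h.
  have /(ae_eq_integral_abs m measurableT mf) := h.
  by apply: (@filterS _ _ (ae_filter_ringOfSetsType m)) => x /(_ I).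
apply/(ae_eq_integral_abs m measurableT mf).
by move: h; apply: (@filterS _ _ (ae_filter_ringOfSetsType m)) => x.
Qed.

End ae_integral.

Section slicing.
Local Open Scope ereal_scope.
Context {R : realType} (n : nat).
Local Notation lebR := (@lebesgue_measure R).
Local Notation lam := (@rV_lebesgue R).

(** Lines that are graphs over the first coordinate: all lines but those of a
null set of directions. *)
Definition line (z c : 'rV[R]_n) (s : R) : 'rV[R]_n.+1 :=
  rV_cons (s, (c + s *: z)%R).

Lemma measurable_line d (T : measurableType d) (z c : T -> 'rV[R]_n) (s : T -> measurableTypeR R) :
  measurable_fun setT z -> measurable_fun setT c -> measurable_fun setT s ->
  measurable_fun setT (fun t => line (z t) (c t) (s t)).
Proof.
move=> mz mc ms; apply: (measurableT_comp (@measurable_rV_cons R n)).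
apply: measurable_fun_pair => //.
apply: measurable_fun_rVP => i; under eq_fun do rewrite !mxE.
apply: measurable_funD; first exact: (measurableT_comp (measurable_coor i) mc).
by apply: measurable_funM => //; exact: (measurableT_comp (measurable_coor i) mz).
Qed.

Lemma lineB z c s t : (line z c t - line z c s = (t - s) *: rV_cons (1%R, z))%R.
Proof.
apply/rowP => i; rewrite [LHS]mxE [X in (_ + X)%R = _]mxE [RHS]mxE.
case: (unliftP ord0 i) => [j ->|->].
  by rewrite !rV_consS !mxE; ring.
by rewrite !rV_cons0 mulr1.
Qed.

(** For each s the translation by s z preserves the measure. *)
Lemma integral_line (f : 'rV[R]_n.+1 -> \bar R) (z : 'rV[R]_n) :
  measurable_fun setT f -> (forall x, 0 <= f x) ->
  \int[lam n.+1]_x f x = \int[lam n]_c \int[lebR]_s f (line z c s).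
Proof.
move=> mf f0.
have mfl : measurable_fun setT (fun p : measurableTypeR R * 'rV[R]_n => f (line z p.2 p.1)).
  apply: (measurableT_comp mf); exact: measurable_line.
rewrite ge0_integral_rVS//.
transitivity (\int[lebR]_s \int[lam n]_c f (line z c s)); last first.
  exact: (fubini_tonelli (m1 := lebR) (m2 := lam n)
    (fun p : measurableTypeR R * 'rV[R]_n => f (line z p.2 p.1)) mfl
    (fun p => f0 _)).
apply: eq_integral => s _.
rewrite (@ge0_integral_rV_affine R n _ (s *: z)%R 1%R) ?oner_neq0//.
  rewrite normr1 expr1n mul1e; apply: eq_integral => c _ /=.
  by rewrite /line scale1r addrC.
apply: (measurableT_comp mf); apply: (measurableT_comp (@measurable_rV_cons R n)).
exact: measurable_pair1.
Qed.

(** For x = (s, x') and y = (t, y') with s <> t, substitute y' = x' + (t - s)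
z, of Jacobian |t - s|^n, and then x' = c + s z. The power |t - s|^n is what
turns the weight |y - x|^-(n+1) of the energy into the one-dimensional weight
1 / |t - s|. *)
Lemma integral_pair_line (g : 'rV[R]_n.+1 * 'rV[R]_n.+1 -> \bar R) :
  measurable_fun setT g -> (forall z, 0 <= g z) ->
  \int[lam n.+1]_x \int[lam n.+1]_y g (x, y) =
  \int[lam n]_z \int[lam n]_c \int[lebR]_s \int[lebR]_t
    ((`|t - s| ^+ n)%:E * g (line z c s, line z c t)).
Proof.
move=> mg g0.
pose dir (x : 'rV[R]_n.+1) (z : 'rV[R]_n) (t : R) : 'rV[R]_n.+1 :=
  rV_cons (t, ((rV_uncons x).2 + (t - x ord0 ord0) *: z)%R).
pose H (p : ('rV[R]_n.+1 * 'rV[R]_n) * measurableTypeR R) : \bar R :=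
  (`|p.2 - p.1.1 ord0 ord0| ^+ n)%:E * g (p.1.1, dir p.1.1 p.1.2 p.2).
have H0 p : 0 <= H p by rewrite mule_ge0// lee_fin exprn_ge0.
have mH : measurable_fun setT H.
  have m11 : measurable_fun setT (fun p : ('rV[R]_n.+1 * 'rV[R]_n) * measurableTypeR R => p.1.1).
    exact: (measurableT_comp measurable_fst measurable_fst).
  have mdiff : measurable_fun setT (fun p : ('rV[R]_n.+1 * 'rV[R]_n) * measurableTypeR R =>
      (p.2 - p.1.1 ord0 ord0)%R).
    by apply: measurable_funB => //; exact: (measurableT_comp (measurable_coor ord0) m11).
  apply: emeasurable_funM.
    by apply/measurable_EFinP; apply: measurable_funX; exact: measurableT_comp.
  apply: (measurableT_comp mg); apply: measurable_fun_pair => //.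
  apply: (measurableT_comp (@measurable_rV_cons R n)).
  apply: measurable_fun_pair => //.
  apply: measurable_fun_rVP => i; under eq_fun do rewrite !mxE.
  apply: measurable_funD; first exact: (measurableT_comp (measurable_coor _) m11).
  apply: measurable_funM => //.
  apply: (measurableT_comp (measurable_coor i)).
  exact: (measurableT_comp measurable_snd measurable_fst).
pose Phi (p : 'rV[R]_n.+1 * 'rV[R]_n) := \int[lebR]_t H (p, t).
have mPhi : measurable_fun setT Phi.
  exact: (measurable_fun_fubini_tonelli_F (m2 := lebR) H).
have Phi0 p : 0 <= Phi p by apply: integral_ge0 => t _; exact: H0.
transitivity (\int[lam n.+1]_x \int[lam n]_z Phi (x, z)).
  apply: eq_integral => x _.
  rewrite ge0_integral_rVS//; last exact: measurable_fun_pair2.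
  rewrite /Phi.
  have mHx : measurable_fun setT (fun p : measurableTypeR R * 'rV[R]_n => H ((x, p.2), p.1)).
    apply: (measurableT_comp mH); apply: measurable_fun_pair => //.
    by apply: measurable_fun_pair.
  transitivity (\int[lebR]_t \int[lam n]_z H ((x, z), t)); last first.
    exact: (fubini_tonelli (m1 := lebR) (m2 := lam n)
      (fun p : measurableTypeR R * 'rV[R]_n => H ((x, p.2), p.1)) mHx
      (fun p => H0 _)).
  have mgx : measurable_fun setT (fun y => g (x, y)) by exact: measurable_fun_pair2.
  have mgc : measurable_fun setT (fun p : measurableTypeR R * 'rV[R]_n => g (x, rV_cons p)).
    exact: (measurableT_comp mgx (@measurable_rV_cons R n)).
  apply: ge0_ae_eq_integral => //.
  - exact: (measurable_fun_fubini_tonelli_F (m2 := lam n)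
      (fun p : measurableTypeR R * 'rV[R]_n => g (x, rV_cons p))).
  - exact: (measurable_fun_fubini_tonelli_F (m2 := lam n)
      (fun p : measurableTypeR R * 'rV[R]_n => H ((x, p.2), p.1))).
  - by move=> t _; apply: integral_ge0.
  - by move=> t _; apply: integral_ge0.
  (* the change of variables y' = x'' + (t - x0) z degenerates at t = x0 *)
  exists [set x ord0 ord0]; split; [exact: measurable_set1|exact: lebesgue_measure_set1|].
  move=> t /= h; apply: contrapT => tx; apply: h => _.
  have tx0 : (t - x ord0 ord0)%R != 0%R by rewrite subr_eq0; apply/eqP.
  rewrite (@ge0_integral_rV_affine R n (fun y => g (x, rV_cons (t, y))) (rV_uncons x).2 _ tx0)//.
    rewrite -ge0_integralZl//.
    apply: (measurableT_comp mgc); apply: measurable_fun_pair => //.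
    exact: measurable_rV_affine.
  exact: (measurableT_comp mgc (measurable_pair1 (t : measurableTypeR R))).
rewrite (fubini_tonelli (m1 := lam n.+1) (m2 := lam n) Phi)//.
apply: eq_integral => z _.
have mPhiz : measurable_fun setT (fun x => Phi (x, z)).
  exact: (measurable_fun_pair1 z mPhi).
rewrite (integral_line z mPhiz); last by move=> x; exact: Phi0.
apply: eq_integral => c _; apply: eq_integral => s _; apply: eq_integral => t _.
have lineE : rV_uncons (line z c s) = (s, (c + s *: z)%R) by exact: rV_consK.
have -> : line z c t = dir (line z c s) z t.
  rewrite /dir [rV_uncons _]lineE /line rV_cons0 /=.
  by rewrite -addrA -scalerDl subrKC.
by rewrite /H /= [X in (t - X)%R](rV_cons0 (s, (c + s *: z)%R)).
Qed.

End slicing.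

(** * From lines to convex domains *)

Section energy_on_lines.
Context {R : realType} (n : nat).
Local Notation mu := (@lebesgue_measure R).
Local Notation lam := (@rV_lebesgue R).
Local Notation rV := 'rV[R]_n.+1.
Variables (om : R -> R).
Hypotheses (om0 : forall x, 0 <= om x) (com : continuous om).
Hypothesis om_gt0 : forall x, 0 < x -> 0 < om x.
Hypothesis om_int : (\int[mu]_(m in `[1%R, +oo[) (om m / m ^+ 2)%:E = +oo)%E.

Definition energy_kernel (u : rV -> R) (Q : set rV) (p : rV * rV) : \bar R :=
  (om (`|u p.2 - u p.1| / enorm (p.2 - p.1)) * (enorm (p.2 - p.1) ^+ n.+1)^-1 *
   (\1_Q p.1 * \1_Q p.2))%:E.

Definition rV_flat_on (Q : set rV) (u : rV -> R) : Prop :=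
  forall eps, 0 < eps -> exists A : (set rV)^nat, exists del : nat -> R,
    [/\ forall k, measurable (A k), nondecreasing_seq A, forall k, 0 < del k,
        forall k x y, A k x -> A k y -> enorm (x - y) < del k ->
          `|u x - u y| <= eps * enorm (x - y)
      & lam n.+1 (Q `\` \bigcup_k A k) = 0%E].

Lemma energy_kernel_ge0 u Q p : (0 <= energy_kernel u Q p)%E.
Proof. by rewrite lee_fin !mulr_ge0// invr_ge0 exprn_ge0// enorm_ge0. Qed.

Lemma measurable_rVB : measurable_fun setT (fun p : rV * rV => p.2 - p.1).
Proof.
apply: measurable_fun_rVP => i; under eq_fun do rewrite !mxE.
by apply: measurable_funB; apply: (measurableT_comp (measurable_coor i)).
Qed.

Lemma measurable_energy_kernel u Q : measurable_fun setT u -> measurable Q ->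
  measurable_fun setT (energy_kernel u Q).
Proof.
move=> mu_ mQ.
have mdist := measurable_enorm measurable_rVB.
apply/measurable_EFinP; apply: measurable_funM; last first.
  apply: measurable_funM.
    by apply: (measurableT_comp _ measurable_fst); exact: measurable_indic.
  by apply: (measurableT_comp _ measurable_snd); exact: measurable_indic.
apply: measurable_funM; last first.
  by apply: (measurableT_comp measurable_invr); exact: measurable_funX.
apply: (measurableT_comp (continuous_measurable_fun com)).
apply: measurable_funM.
  apply: measurableT_comp => //; apply: measurable_funB.
    exact: (measurableT_comp mu_ measurable_snd).
  exact: (measurableT_comp mu_ measurable_fst).
exact: (measurableT_comp measurable_invr).
Qed.

Lemma enorm_cons1_gt0 (z : 'rV[R]_n) : 0 < enorm (rV_cons (1, z)).
Proof.
apply: lt_le_trans (coor_le_enorm _ ord0).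
by rewrite rV_cons0 normr1.
Qed.

Lemma enorm_line (z c : 'rV[R]_n) s t :
  enorm (line z c t - line z c s) = `|t - s| * enorm (rV_cons (1, z)).
Proof. by rewrite lineB enormZ. Qed.

(** Dividing u by the length of (1, z) absorbs the parametrization of the
line, so that the same om appears on both sides. *)
Lemma energy_kernel_line u Q (z c : 'rV[R]_n) (s t : R) :
  ((`|t - s| ^+ n)%:E * energy_kernel u Q (line z c s, line z c t) =
   ((enorm (rV_cons (1, z)) ^+ n.+1)^-1)%:E *
   line_kernel om (fun s => u (line z c s) / enorm (rV_cons (1, z)))%R
      (line z c @^-1` Q) (s, t))%E.
Proof.
have k0 := enorm_cons1_gt0 z; set k := enorm _ in k0 *.
rewrite /energy_kernel /line_kernel /quotient /= enorm_line -/k -!EFinM; congr (_%:E).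
rewrite !mulrA; congr (_ * _ * _).
have [->|st] := eqVneq s t.
  by rewrite subrr normr0 mul0r exprS mul0r !invr0 !mulr0.
have d0 : 0 < `|t - s| by rewrite normr_gt0 subr_eq0 eq_sym.
have -> : `|(u (line z c t) / k - u (line z c s) / k) / (t - s)| =
    `|u (line z c t) - u (line z c s)| / (`|t - s| * k).
  rewrite -mulrBl !normrM !normfV (gtr0_norm k0).
  by field; rewrite !gt_eqF.
rewrite exprMn [X in _ / (X * _)]exprS.
field.
by rewrite !expf_neq0 ?gt_eqF.
Qed.

(** For each eps the exceptional null set meets almost every line in a null
set; taking eps = 1/(j+1) only, only countably many null sets of lines are
left out. *)
Lemma flat_line u Q (z : 'rV[R]_n) : measurable Q -> rV_flat_on Q u ->
  {ae lam n, forall c, flat_on (line z c @^-1` Q)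
     (fun s => u (line z c s) / enorm (rV_cons (1, z)))}.
Proof.
move=> mQ flat.
have k0 := enorm_cons1_gt0 z; set k := enorm _ in k0 *.
have eps0 j : 0 < j.+1%:R^-1 :> R by rewrite invr_gt0.
pose A j := projT1 (cid (flat _ (eps0 j))).
pose del j := projT1 (cid (projT2 (cid (flat _ (eps0 j))))).
have AP j : [/\ forall k, measurable (A j k), nondecreasing_seq (A j), forall k, 0 < del j k,
        forall k x y, A j k x -> A j k y -> enorm (x - y) < del j k ->
          `|u x - u y| <= j.+1%:R^-1 * enorm (x - y)
      & lam n.+1 (Q `\` \bigcup_k A j k) = 0%E].
  exact: (projT2 (cid (projT2 (cid (flat _ (eps0 j)))))).
have mline c : measurable_fun setT (line z c : measurableTypeR R -> rV).
  exact: measurable_line.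
have mlinepre c (X : set rV) : measurable X -> measurable (line z c @^-1` X : set (measurableTypeR R)).
  by move=> mX; rewrite -[X in measurable X]setTI; exact: mline.
have : {ae lam n, forall c, forall j, mu (line z c @^-1` (Q `\` \bigcup_k A j k)) = 0%E}.
  apply: ae_foralln => j; have [mA _ _ _ N0] := AP j.
  set N := Q `\` _ in N0 *.
  have mN : measurable N by apply: measurableD => //; exact: bigcupT_measurable.
  have mf : measurable_fun setT (fun x => (\1_N x)%:E : \bar R).
    by apply/measurable_EFinP; exact: measurable_indic.
  have : (\int[lam n.+1]_x (\1_N x)%:E = 0)%E by rewrite integral_indic// setIT.
  rewrite (integral_line z mf); last by move=> x; rewrite lee_fin.
  move=> /ge0_integral0_ae; case.
  - apply: (measurable_fun_fubini_tonelli_F (m2 := mu)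
      (fun p : 'rV[R]_n * measurableTypeR R => (\1_N (line z p.1 p.2))%:E)).
      by apply: (measurableT_comp mf); exact: measurable_line.
    by move=> p; rewrite lee_fin.
  - by move=> c; apply: integral_ge0 => s _; rewrite lee_fin.
  move=> X [mX X0 sX]; exists X; split => //; apply: subset_trans sX.
  move=> c /= h h2; apply: h; rewrite -[RHS]h2.
  rewrite -[X in mu X]setIT -integral_indic//; exact: mlinepre.
apply: (@filterS _ _ (ae_filter_ringOfSetsType (lam n))) => c h eps epsgt0.
have [j _ Hj] := near_natSinv_lt epsgt0.
have {}Hj := Hj j (leqnn j).
have [mA ndA del0 lip _] := AP j.
exists (fun m => line z c @^-1` A j m), (fun m => del j m / k).
split.
- by move=> m; exact: mlinepre.
- by move=> m m' mm'; apply/subsetPset; apply: preimage_subset; exact/subsetPset/ndA.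
- by move=> m; rewrite divr_gt0.
- move=> m s t As At st; rewrite -mulrBl normrM normfV (gtr0_norm k0).
  rewrite ler_pdivrMr// -mulrA -(enorm_line z c).
  apply: le_trans (lip _ _ _ As At _) _.
    by rewrite enorm_line -ltr_pdivlMr.
  by rewrite ler_wpM2r ?enorm_ge0// ltW.
- by rewrite -preimage_bigcup; exact: h.
Qed.

End energy_on_lines.

Section pairs_of_points.
Context {R : realType} (n : nat).
Local Notation mu := (@lebesgue_measure R).
Local Notation lam := (@rV_lebesgue R).
Local Notation rV := 'rV[R]_n.+1.
Variables (om : R -> R).
Hypotheses (om0 : forall x, 0 <= om x) (com : continuous om).
Hypothesis om_gt0 : forall x, 0 < x -> 0 < om x.
Hypothesis om_int : (\int[mu]_(m in `[1%R, +oo[) (om m / m ^+ 2)%:E = +oo)%E.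

Definition line_convex (Q : set rV) := forall z c s t r,
  Q (line z c s) -> Q (line z c t) -> s <= r <= t -> Q (line z c r).

Definition differ (u : rV -> R) (Q : set rV) : set (rV * rV) :=
  [set p | [/\ Q p.1, Q p.2 & u p.1 != u p.2]].

Lemma measurable_differ u Q : measurable_fun setT u -> measurable Q ->
  measurable (differ u Q).
Proof.
move=> mfu mQ.
have -> : differ u Q = (Q `*` Q) `&` ((fun p : rV * rV => u p.1 - u p.2) @^-1` (~` [set 0])).
  apply/seteqP; split => [[x y] [/= Qx Qy /eqP xy]|[x y] [[/= Qx Qy] xy]].
    by split => //=; apply/eqP; rewrite subr_eq0; exact/eqP.
  by split => //=; rewrite -subr_eq0; exact/eqP.
apply: measurableI; first exact: measurableX.
rewrite -[X in measurable X]setTI.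
have : measurable_fun setT (fun p : rV * rV => u p.1 - u p.2).
  apply: measurable_funB.
    exact: (measurableT_comp mfu measurable_fst).
  exact: (measurableT_comp mfu measurable_snd).
by apply => //; exact: measurableC.
Qed.

(** In a pair of distinct values at least one differs from c0, so that the set
of the pairs is covered by two null strips. *)
Lemma line_differ0 (u : rV -> R) (Q : set rV) (z c : 'rV[R]_n) (c0 : R) :
  measurable_fun setT u -> measurable Q ->
  mu (line z c @^-1` (Q `&` [set x | u x != c0])) = 0%E ->
  (\int[mu]_s \int[mu]_t ((`|t - s| ^+ n)%:E *
    (\1_(differ u Q) (line z c s, line z c t))%:E) = 0)%E.
Proof.
move=> mfu mQ N0.
set N := line z c @^-1` _ in N0.
have mline : measurable_fun setT (line z c : measurableTypeR R -> rV).
  exact: measurable_line.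
have mN : measurable (N : set (measurableTypeR R)).
  rewrite -[X in measurable X]setTI; apply: mline => //; apply: measurableI => //.
  rewrite (_ : [set _ | _] = u @^-1` (~` [set c0])).
    by rewrite -[X in measurable X]setTI; apply: mfu => //; exact: measurableC.
  by apply/seteqP; split => x /= /eqP.
pose G (p : measurableTypeR R * measurableTypeR R) := ((`|p.2 - p.1| ^+ n)%:E *
    (\1_(differ u Q) (line z c p.1, line z c p.2))%:E)%E.
have mG : measurable_fun setT G.
  apply: emeasurable_funM; apply/measurable_EFinP.
    apply: measurable_funX; apply: measurableT_comp => //.
    exact: measurable_funB.
  apply: (measurableT_comp (measurable_indic (measurable_differ mfu mQ))).
  by apply: measurable_fun_pair; apply: (measurableT_comp mline).
have G0 p : (0 <= G p)%E by rewrite mule_ge0// lee_fin exprn_ge0.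
apply/ge0_integral0_ae.
- exact: (measurable_fun_fubini_tonelli_F (m2 := mu) G mG G0).
- by move=> s; apply: integral_ge0 => t _; exact: (G0 (s, t)).
exists N; split => // s /=; apply: contra_notP => nNs.
apply/ge0_integral0_ae.
- exact: (measurable_fun_pair2 (s : measurableTypeR R) mG).
- by move=> t; exact: (G0 (s, t)).
exists N; split => // t /=; apply: contra_notP => nNt.
rewrite indicE memNset ?mule0// => -[/= Qs Qt /eqP].
have us : u (line z c s) = c0.
  by apply: contrapT => h; apply: nNs; split => //; exact/eqP.
have ut : u (line z c t) = c0.
  by apply: contrapT => h; apply: nNt; split => //; exact/eqP.
by rewrite us ut.
Qed.

(** For almost every z and c the slice of the energy is finite;
[line_energy_constant] then makes u constant on the slice, so that the slice
of [differ] is null. *)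
Lemma finite_energy_pairs (u : rV -> R) (Q : set rV) (M : R) :
  measurable_fun setT u -> measurable Q -> line_convex Q ->
  (forall x, Q x -> `|u x| <= M) -> rV_flat_on Q u ->
  (\int[lam n.+1]_x \int[lam n.+1]_y energy_kernel om u Q (x, y) < +oo)%E ->
  (\int[lam n.+1]_x \int[lam n.+1]_y (\1_(differ u Q) (x, y))%:E = 0)%E.
Proof.
move=> mfu mQ cQ uM flat.
have mE := measurable_energy_kernel com mfu mQ.
have E0 p : (0 <= energy_kernel om u Q p)%E by exact: energy_kernel_ge0.
have mD : measurable_fun setT (fun p => (\1_(differ u Q) p)%:E : \bar R).
  by apply/measurable_EFinP; apply: measurable_indic; exact: measurable_differ.
have D0 p : (0 <= (\1_(differ u Q) p)%:E :> \bar R)%E by rewrite lee_fin.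
rewrite (integral_pair_line mE E0) (integral_pair_line mD D0).
pose W (h : rV * rV -> \bar R) (p : (('rV[R]_n * 'rV[R]_n) * measurableTypeR R) * measurableTypeR R) :=
  ((`|p.2 - p.1.2| ^+ n)%:E * h (line p.1.1.1 p.1.1.2 p.1.2, line p.1.1.1 p.1.1.2 p.2))%E.
have W0 h p : (forall q, (0 <= h q)%E) -> (0 <= W h p)%E.
  by move=> h0; rewrite mule_ge0// lee_fin exprn_ge0.
have mW h : measurable_fun setT h -> measurable_fun setT (W h).
  move=> mh; apply: emeasurable_funM.
    apply/measurable_EFinP; apply: measurable_funX; apply: measurableT_comp => //.
    apply: measurable_funB => //.
    exact: (measurableT_comp measurable_snd measurable_fst).
  apply: (measurableT_comp mh).
  have m1 : measurable_fun setT (fun p : (('rV[R]_n * 'rV[R]_n) * measurableTypeR R) * measurableTypeR R => p.1.1).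
    exact: (measurableT_comp measurable_fst measurable_fst).
  apply: measurable_fun_pair; apply: measurable_line => //.
  - exact: (measurableT_comp measurable_fst m1).
  - exact: (measurableT_comp measurable_snd m1).
  - exact: (measurableT_comp measurable_snd measurable_fst).
  - exact: (measurableT_comp measurable_fst m1).
  - exact: (measurableT_comp measurable_snd m1).
pose W1 h p := (\int[mu]_t W h (p, t))%E.
pose W2 h p := (\int[mu]_s W1 h (p, s))%E.
have W10 h p : (forall q, (0 <= h q)%E) -> (0 <= W1 h p)%E.
  by move=> h0; apply: integral_ge0 => t _; exact: W0.
have W20 h p : (forall q, (0 <= h q)%E) -> (0 <= W2 h p)%E.
  by move=> h0; apply: integral_ge0 => t _; exact: W10.
have mW1 h : (forall q, (0 <= h q)%E) -> measurable_fun setT h -> measurable_fun setT (W1 h).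
  move=> h0 mh.
  exact: (measurable_fun_fubini_tonelli_F (m2 := mu) (W h) (mW h mh) (fun p => W0 h p h0)).
have mW2 h : (forall q, (0 <= h q)%E) -> measurable_fun setT h -> measurable_fun setT (W2 h).
  move=> h0 mh.
  exact: (measurable_fun_fubini_tonelli_F (m2 := mu) (W1 h) (mW1 h h0 mh) (fun p => W10 h p h0)).
pose W3 h z := (\int[lam n]_c W2 h (z, c))%E.
have W30 h z : (forall q, (0 <= h q)%E) -> (0 <= W3 h z)%E.
  by move=> h0; apply: integral_ge0 => t _; exact: W20.
have mW3 h : (forall q, (0 <= h q)%E) -> measurable_fun setT h -> measurable_fun setT (W3 h).
  move=> h0 mh.
  exact: (measurable_fun_fubini_tonelli_F (m2 := lam n) (W2 h) (mW2 h h0 mh) (fun p => W20 h p h0)).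
rewrite -[X in (X < _)%E -> _]/(\int[lam n]_z W3 (energy_kernel om u Q) z)%E.
rewrite -[X in _ -> X = _]/(\int[lam n]_z W3 (fun p => (\1_(differ u Q) p)%:E) z)%E.
move=> fin; apply/(ge0_integral0_ae _ (mW3 _ D0 mD)); first by move=> z; exact: W30.
have := ge0_integral_lty_ae (mW3 _ E0 mE) (fun z => W30 _ z E0) fin.
apply: (@filterS _ _ (ae_filter_ringOfSetsType (lam n))) => z finz.
apply/(ge0_integral0_ae _ (measurable_fun_pair2 z (mW2 _ D0 mD))).
  by move=> c; exact: W20.
have aefin := ge0_integral_lty_ae (measurable_fun_pair2 z (mW2 _ E0 mE)) (fun c => W20 _ _ E0) finz.
have aeflat := flat_line z mQ flat.
apply: (@filterS2 _ _ (ae_filter_ringOfSetsType (lam n)) _ _ _ _ aefin aeflat) => c finc flatc.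
have k0 := enorm_cons1_gt0 z; set k := enorm _ in k0 flatc.
have mline : measurable_fun setT (line z c : measurableTypeR R -> rV).
  exact: measurable_line.
have mw : measurable_fun setT (fun s => u (line z c s) / k).
  by apply: measurable_funM => //; exact: (measurableT_comp mfu mline).
have mS : measurable (line z c @^-1` Q : set (measurableTypeR R)).
  by rewrite -[X in measurable X]setTI; exact: mline.
have [c0 Hc0] : exists c0, mu ((line z c @^-1` Q) `&` [set s | u (line z c s) / k != c0]) = 0%E.
  apply: (line_energy_constant om0 com om_gt0 om_int (M := M / k) mw mS _ _ flatc).
  - by move=> x y r Sx Sy; exact: cQ.
  - by move=> x Qx; rewrite normrM normfV (gtr0_norm k0) ler_pM2r ?invr_gt0// uM.
  - have mL := measurable_line_kernel com mw mS.
    have L0 p : (0 <= line_kernel om (fun s => (u (line z c s) / k)%R) (line z c @^-1` Q) p)%E.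
      exact: line_kernel_ge0.
    have C0 : 0 < (k ^+ n.+1)^-1 by rewrite invr_gt0 exprn_gt0.
    have : (W2 (energy_kernel om u Q) (z, c) = ((k ^+ n.+1)^-1)%:E *
        \int[mu]_s \int[mu]_t line_kernel om (fun s => (u (line z c s) / k)%R)
          (line z c @^-1` Q) (s, t))%E.
      rewrite -ge0_integralZl//; last 3 first.
      - exact: (measurable_fun_fubini_tonelli_F (m2 := mu) _ mL L0).
      - by move=> s _; apply: integral_ge0.
      - by rewrite lee_fin ltW.
      apply: eq_integral => s _; rewrite -ge0_integralZl//; last 2 first.
      - exact: (measurable_fun_pair2 (s : measurableTypeR R) mL).
      - by rewrite lee_fin ltW.
      by apply: eq_integral => t _; rewrite /W /= energy_kernel_line.
    move=> W2E; move: finc; rewrite W2E !ltey => /eqP h; apply/eqP => h2; apply: h.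
    by rewrite h2 gt0_muley// lte_fin.
apply: (@line_differ0 u Q z c (c0 * k)) => //.
rewrite -[RHS]Hc0; congr (mu _); apply/seteqP; split => s [Qs /= h]; split => //=.
  by move: h; apply: contra => /eqP <-; rewrite divfK// gt_eqF.
by move: h; apply: contra => /eqP ->; rewrite mulfK// gt_eqF.
Qed.

End pairs_of_points.

(** * Points with a nonzero approximate differential *)

Section nonzero_differential.
Context {R : realType} (n : nat).
Local Notation mu := (@lebesgue_measure R).
Local Notation lam := (@rV_lebesgue R).
Local Notation rV := 'rV[R]_n.+1.

Definition defect (u : rV -> R) (L : rV -> R) (eps : R) (x : rV) : set rV :=
  [set y | eps * enorm (y - x) < `|u y - u x - L (y - x)|].

(** Approximate differentiability for a Borel function defined everywhere,
with sup-norm balls and with their measure r^(n+1) up to a constant. *)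
Definition adiff (u : rV -> R) (x : rV) (L : rV -> R) : Prop :=
  forall eps eta, 0 < eps -> 0 < eta -> exists2 r0, 0 < r0 &
    forall r, 0 < r < r0 ->
      (lam n.+1 (defect u L eps x `&` ball x r) <= (eta * r ^+ n.+1)%:E)%E.

Lemma linear_bound (L : {linear rV -> R^o}) :
  exists2 K : R, 0 <= K & forall (v : rV) b, (forall i, `|v ord0 i| <= b) -> `|L v| <= K * b.
Proof.
exists (\sum_i `|L (delta_mx ord0 i)|); first by rewrite sumr_ge0.
move=> v b vb; rewrite {1}(row_sum_delta v) linear_sum.
apply: (le_trans (ler_norm_sum _ _ _)); rewrite mulr_suml; apply: ler_sum => i _.
by rewrite linearZ/= normrM mulrC ler_wpM2l.
Qed.

Lemma measurable_linear (L : {linear rV -> R^o}) : measurable_fun setT (L : rV -> R).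
Proof.
rewrite (_ : (L : rV -> R) = fun v => \sum_i v ord0 i * L (delta_mx ord0 i)).
  apply: measurable_sum => i; apply: measurable_funM => //; exact: measurable_coor.
apply/funext => v; rewrite {1}(row_sum_delta v) linear_sum.
by apply: eq_bigr => i _; rewrite linearZ.
Qed.

Lemma measurable_rV_sub (x : rV) : measurable_fun setT (fun y : rV => y - x : rV).
Proof.
apply: measurable_fun_rVP => i; under eq_fun do rewrite !mxE.
by apply: measurable_funB => //; exact: measurable_coor.
Qed.

Lemma measurable_defect u (L : {linear rV -> R^o}) eps x : measurable_fun setT u ->
  measurable (defect u L eps x).
Proof.
move=> mfu.
have : measurable_fun setT (fun y : rV => eps * enorm (y - x) < `|u y - u x - L (y - x)|).
  apply: measurable_fun_ltr.
    by apply: measurable_funM => //; apply: measurable_enorm; exact: measurable_rV_sub.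
  apply: measurableT_comp => //; apply: measurable_funB.
    exact: measurable_funB.
  exact: (measurableT_comp (measurable_linear L) (measurable_rV_sub x)).
by move=> /(_ measurableT [set true]); rewrite setTI; exact.
Qed.

Lemma ge0_integral_pieces_infty d (T : measurableType d)
    (m : {measure set T -> \bar R}) (f : T -> \bar R) (C : (set T)^nat) (c : R) :
  measurable_fun setT f -> (forall x, 0 <= f x)%E -> (forall k, measurable (C k)) ->
  trivIset setT C -> 0 < c -> (forall k, (c%:E <= \int[m]_(x in C k) f x)%E) ->
  (\int[m]_x f x = +oo)%E.
Proof.
move=> mf f0 mC tC c0 cC.
apply/eqP; rewrite -leye_eq.
have le1 : (\int[m]_(x in \bigcup_k C k) f x <= \int[m]_x f x)%E.
  by apply: ge0_subset_integral => //; exact: bigcupT_measurable.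
apply: le_trans le1; rewrite ge0_integral_bigcup//; last exact: measurable_funTS.
rewrite leye_eq; apply/eqP/eqyP => A A0.
have [N HN] : exists N : nat, A <= N%:R * c.
  exists (Num.truncn (A / c)).+1; rewrite -ler_pdivrMr// ltW//; exact: truncnS_gt.
apply: (@le_trans _ _ (\sum_(0 <= k < N) \int[m]_(x in C k) f x)%E); last first.
  by apply: nneseries_lim_ge => k _ _; apply: integral_ge0 => x _; exact: f0.
apply: (@le_trans _ _ (\sum_(0 <= k < N) c%:E)%E); last exact: lee_sum.
by rewrite sumEFin lee_fin big_mkord sumr_const card_ord -mulr_natl.
Qed.

Variables (om : R -> R).
Hypotheses (om0 : forall x, 0 <= om x) (com : continuous om).
Hypothesis om_gt0 : forall x, 0 < x -> 0 < om x.

(** Take e0 with L e0 = 2 and the balls of centre x + r e0 and radius r rho.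
If rho is small, L (y - x) lies between r and 3 r on such a ball, so that the
balls with r = r1 / 4^k are disjoint. Once the points where u differs too much
from its differential are removed, which leaves at least half of the ball if r
is small, the slopes are in a fixed compact subset of ]0, +oo[. By homogeneity
all these pieces contribute at least the same positive amount. *)
Lemma nonzero_differential_infinite (u : rV -> R) (Omega : set rV) (x e : rV)
    (L : {linear rV -> R^o}) :
  measurable_fun setT u -> open Omega -> Omega x -> L e != 0 -> adiff u x L ->
  (\int[lam n.+1]_y energy_kernel om u Omega (x, y) = +oo)%E.
Proof.
move=> mfu oO Ox Le dL.
have mO := open_measurable_rV oO.
have [K K0 LK] := linear_bound L.
pose e0 : rV := (2 / L e) *: e.
have Le0 : L e0 = 2 by rewrite /e0 linearZ/= /GRing.scale/= divfK.
pose b0 := enorm e0.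
have b00 : 0 <= b0 by exact: enorm_ge0.
have K10 : 0 < K + 1 by rewrite ltr_wpDl.
pose rho := (K + 1)^-1.
have rho0 : 0 < rho by rewrite invr_gt0.
have Krho : K * rho <= 1 by rewrite ler_pdivrMr// mul1r lerDl.
pose b := b0 + rho.
have bgt0 : 0 < b by rewrite ltr_wpDl.
pose a2 := n.+1%:R * b.
have a20 : 0 < a2 by rewrite mulr_gt0.
have [c c0 omc] : exists2 c, 0 < c & forall m, (2 * a2)^-1 <= m <= 4 * (K + 1) -> c <= om m.
  have [h|h] := leP ((2 * a2)^-1) (4 * (K + 1)); last first.
    exists 1 => // m /andP[m1 m2].
    by have := lt_le_trans h (le_trans m1 m2); rewrite ltxx.
  have [m hm Hm] := EVT_min h (continuous_subspaceT com).
  exists (om m) => [|t ht]; last by apply: Hm; rewrite in_itv.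
  apply: om_gt0; move: hm; rewrite in_itv/= => /andP[m1 _].
  by apply: lt_le_trans m1; rewrite invr_gt0 mulr_gt0.
have eps0 : 0 < (2 * a2)^-1 by rewrite invr_gt0 mulr_gt0.
(* with this eta the bad points occupy at most (r rho)^(n+1), at most half of
   the ball *)
have eta0 : 0 < (rho / b) ^+ n.+1 by rewrite exprn_gt0// divr_gt0.
have [r0 r00 Hr0] := dL _ _ eps0 eta0.
set Df := defect u L _ x in Hr0.
have mDf : measurable Df by exact: measurable_defect.
move: (open_nbhs_nbhs (conj oO Ox)); rewrite -nbhs_ballE => -[R1 /= R10 R1O].
pose r1 := Num.min r0 R1 / (2 * b).
have r10 : 0 < r1 by rewrite divr_gt0 ?mulr_gt0// lt_min r00.
pose r (k : nat) := r1 / 4 ^+ k.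
have rgt0 k : 0 < r k by rewrite divr_gt0// exprn_gt0.
have rle k : r k <= r1.
  by rewrite ler_pdivrMr ?exprn_gt0// ler_peMr ?(ltW r10)// exprn_ege1// ler1n.
have rb k : 0 < r k * b < Num.min r0 R1.
  rewrite mulr_gt0//=; apply: (@le_lt_trans _ _ (r1 * b)); first by rewrite ler_pM2r.
  have -> : r1 * b = Num.min r0 R1 / 2 by rewrite /r1; field; rewrite gt_eqF.
  by rewrite ltr_pdivrMr// ltr_pMr ?ltr1n// lt_min r00.
have rbr0 k : 0 < r k * b < r0.
  by have /andP[-> /=] := rb k; rewrite lt_min => /andP[].
have rbR1 k : r k * b < R1.
  by have /andP[_] := rb k; rewrite lt_min => /andP[].
pose Bk k : set rV := ball (x + r k *: e0) (r k * rho).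
have Bcoor k y : Bk k y -> forall i, `|(y - x) ord0 i - r k * e0 ord0 i| < r k * rho.
  have rr : 0 < r k * rho by rewrite mulr_gt0.
  move=> /(ball_rVP _ _ rr) h i; have := h i; rewrite !mxE distrC.
  by congr (_ < _); congr (`| _ |); ring.
have Bsmall k y : Bk k y -> forall i, `|(y - x) ord0 i| < r k * b.
  move=> By i; have h := Bcoor k y By i.
  have := ler_normD ((y - x) ord0 i - r k * e0 ord0 i) (r k * e0 ord0 i).
  have hB : `|r k * e0 ord0 i| <= r k * b0.
    by rewrite normrM gtr0_norm// ler_pM2l// coor_le_enorm.
  rewrite subrK => /le_lt_trans; apply; rewrite /b mulrDr [ltRHS]addrC.
  exact: ltr_leD.
have Bball k : Bk k `<=` ball x (r k * b).
  move=> y By; apply/ball_rVP; first by have /andP[] := rb k.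
  by move=> i; have := Bsmall k y By i; rewrite !mxE distrC.
have BL k y : Bk k y -> r k <= L (y - x) <= 3 * r k.
  move=> By.
  have : `|L ((y - x) - r k *: e0)| <= K * (r k * rho).
    by apply: LK => i; have := Bcoor k y By i; rewrite !mxE => /ltW.
  rewrite linearB/= [L (r k *: e0)]linearZ/= Le0 /GRing.scale/=.
  have : K * (r k * rho) <= r k by rewrite mulrCA ger_pMr.
  move=> h1 h2; have := le_trans h2 h1.
  by rewrite ler_norml => /andP[h3 h4]; apply/andP; split; clear -h3 h4; lra.
pose C k := Bk k `\` Df.
have mBk k : measurable (Bk k) by exact: measurable_ball_rV.
have mC k : measurable (C k) by exact: measurableD.
have r4 k : r k.+1 = r k / 4 by rewrite /r exprS; field; rewrite expf_neq0.
have rdecr j k : (j < k)%N -> 3 * r k < r j.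
  move=> jk; rewrite -(subnKC jk); elim: (k - j.+1)%N => [|m IH].
    by rewrite addn0 r4; have := rgt0 j; lra.
  by rewrite addnS r4; have := rgt0 (j.+1 + m)%N; lra.
have tC : trivIset setT C.
  apply/trivIsetP => i j _ _ ij; apply/seteqP; split => // y [[Bi _] [Bj _]].
  have /andP[i1 i2] := BL i y Bi; have /andP[j1 j2] := BL j y Bj.
  move: ij; rewrite neq_ltn => /orP[/rdecr h|/rdecr h].
    by have := le_lt_trans j2 (lt_le_trans h i1); rewrite ltxx.
  by have := le_lt_trans i2 (lt_le_trans h j1); rewrite ltxx.
have mE : measurable_fun setT (fun y => energy_kernel om u Omega (x, y)).
  exact: (measurable_fun_pair2 x (measurable_energy_kernel com mfu mO)).
apply: (@ge0_integral_pieces_infty _ _ _ _ C (c * (rho / a2) ^+ n.+1)) => //.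
- by move=> y; exact: energy_kernel_ge0.
- by rewrite mulr_gt0// exprn_gt0// divr_gt0.
move=> k.
have kerval y : C k y ->
    ((c * ((r k * a2) ^+ n.+1)^-1)%:E <= energy_kernel om u Omega (x, y))%E.
  move=> [By nDy].
  have Oy : Omega y by apply: R1O; apply: le_ball (Bball k y By); exact: ltW.
  have ebig : enorm (y - x) <= r k * a2.
    rewrite /a2 mulrCA; apply: enorm_le_coor; first by rewrite ltW// mulr_gt0.
    by move=> i; exact/ltW/Bsmall.
  have /andP[L1 L3] := BL k y By.
  have esmall : r k <= (K + 1) * enorm (y - x).
    apply: (le_trans L1); apply: (le_trans (ler_norm _)).
    apply: (le_trans (LK _ _ (coor_le_enorm _))).
    by rewrite ler_wpM2r ?enorm_ge0// lerDl.
  have e_gt0 : 0 < enorm (y - x).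
    by rewrite -(pmulr_rgt0 _ K10); exact: lt_le_trans esmall.
  have : `|u y - u x - L (y - x)| <= r k / 2.
    have /negP := nDy; rewrite /Df/= -leNgt => /le_trans; apply.
    rewrite mulrC ler_pdivrMr ?mulr_gt0//.
    by have -> : r k / 2 * (2 * a2) = r k * a2 by field.
  rewrite ler_norml => /andP[u1 u2].
  have u0 : 0 < u y - u x by have := rgt0 k; clear -u1 u2 L1 L3; lra.
  rewrite /energy_kernel /= lee_fin !indicE !mem_set// !mulr1 gtr0_norm//.
  apply: ler_pM; [exact: ltW| | |].
  - by rewrite invr_ge0 exprn_ge0// ltW// mulr_gt0.
  - apply: omc; apply/andP; split.
      rewrite ler_pdivlMr// mulrC ler_pdivrMr ?mulr_gt0//.
      apply: (le_trans ebig).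
      have -> : (u y - u x) * (2 * a2) = (2 * (u y - u x)) * a2 by ring.
      by rewrite ler_pM2r//; clear -u1 L1; lra.
    rewrite ler_pdivrMr// -mulrA.
    have := rgt0 k; clear -u2 L3 esmall; lra.
  - have rka2 : 0 < r k * a2 by rewrite mulr_gt0.
    rewrite lef_pV2 ?posrE ?exprn_gt0//.
    by rewrite lerXn2r// nnegrE ?enorm_ge0// ltW// mulr_gt0.
have c10 : 0 <= c * ((r k * a2) ^+ n.+1)^-1.
  by rewrite mulr_ge0 ?(ltW c0)// invr_ge0 exprn_ge0// ltW// mulr_gt0.
have := @ge0_integral_ge_cst_on _ _ _ (lam n.+1) _ (fun y => energy_kernel om u Omega (x, y)) _ (mC k) (measurable_funTS mE) c10 kerval.
apply: le_trans.
have lamB : lam n.+1 (Bk k) = (((r k * rho) *+ 2) ^+ n.+1)%:E.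
  by apply: rV_lebesgue_ball; rewrite mulr_gt0.
have lamC : (((r k * rho) ^+ n.+1)%:E <= lam n.+1 (C k))%E.
  have H1 : (lam n.+1 (Bk k) <= lam n.+1 (C k) + lam n.+1 (Df `&` ball x (r k * b)))%E.
    have mDb : measurable (Df `&` ball x (r k * b)).
      by apply: measurableI => //; exact: measurable_ball_rV.
    apply: le_trans (measureU2 _ (mC k) mDb).
    apply: le_measure; rewrite ?inE//; first exact: measurableU.
    move=> y By; have [Dy|nDy] := pselect (Df y); last by left.
    by right; split => //; exact: Bball.
  have H2 := Hr0 _ (rbr0 k).
  have H3 : (rho / b) ^+ n.+1 * (r k * b) ^+ n.+1 = (r k * rho) ^+ n.+1.
    by rewrite -exprMn; congr (_ ^+ _); field; rewrite gt_eqF.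
  rewrite H3 in H2.
  have H4 := le_trans H1 (leeD2l _ H2).
  rewrite lamB in H4.
  have H5 : ((r k * rho) ^+ n.+1) *+ 2 <= ((r k * rho) *+ 2) ^+ n.+1.
    rewrite -[r k * rho *+ 2]mulr_natl [leRHS]exprMn -[leLHS]mulr_natl ler_wpM2r//.
      by rewrite exprn_ge0// ltW// mulr_gt0.
    by rewrite exprS ler_peMr// exprn_ege1// ler1n.
  rewrite -(leeD2rE (x := ((r k * rho) ^+ n.+1)%:E))//.
  by apply: le_trans H4; rewrite -EFinD lee_fin -mulr2n.
apply: le_trans (lee_wpmul2l _ lamC); last by rewrite lee_fin.
rewrite -EFinM lee_fin -mulrA ler_pM2l// -exprVn -exprMn.
rewrite le_eqVlt; apply/orP; left; apply/eqP; congr (_ ^+ _); field.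
by rewrite !gt_eqF.
Qed.

End nonzero_differential.

(** * Points with zero approximate differential *)

Section zero_differential.
Context {R : realType} (n : nat).
Local Notation lam := (@rV_lebesgue R).
Local Notation rV := 'rV[R]_n.+1.

Lemma measurable_ball_pair (q : R) : 0 < q ->
  measurable [set p : rV * rV | ball p.1 q p.2].
Proof.
move=> q0.
rewrite (_ : [set _ | _] = \bigcap_(i in [set: 'I_n.+1])
    ((fun p : rV * rV => (p.1 ord0 i - p.2 ord0 i : measurableTypeR R)) @^-1` ball 0 q)).
  apply: fin_bigcap_measurable => // i _.
  rewrite -[X in measurable X]setTI.
  have mf : measurable_fun setT (fun p : rV * rV => (p.1 ord0 i - p.2 ord0 i)).
    by apply: measurable_funB; apply: (measurableT_comp (measurable_coor i)).
  by apply: mf => //; exact: measurable_ball.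
apply/seteqP; split => [[x y] /(ball_rVP _ _ q0) h i _|[x y] h].
  by rewrite /= /ball/= sub0r normrN.
by apply/ball_rVP => // i; have := h i I; rewrite /= /ball/= sub0r normrN.
Qed.

Lemma measurable_defect_ball (u : rV -> R) (eps q c : R) :
  measurable_fun setT u -> 0 < q ->
  measurable [set x | (lam n.+1 (defect u (fun=> 0%R) eps x `&` ball x q) <= c%:E)%E].
Proof.
move=> mfu q0.
pose E := [set p : rV * rV | eps * enorm (p.2 - p.1) < `|u p.2 - u p.1 - 0|] `&`
  [set p : rV * rV | ball p.1 q p.2].
have mE : measurable E.
  apply: measurableI; last exact: measurable_ball_pair.
  have : measurable_fun setT (fun p : rV * rV => eps * enorm (p.2 - p.1) < `|u p.2 - u p.1 - 0|).
    apply: measurable_fun_ltr.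
      by apply: measurable_funM => //; apply: measurable_enorm; exact: measurable_rVB.
    apply: measurableT_comp => //; apply: measurable_funB => //; apply: measurable_funB.
      exact: (measurableT_comp mfu measurable_snd).
    exact: (measurableT_comp mfu measurable_fst).
  by move=> /(_ measurableT [set true]); rewrite setTI; exact.
have := measurable_fun_xsection (lam n.+1) mE.
move=> /(emeasurable_fun_infty_c measurableT) /(_ c%:E); rewrite setTI.
congr (measurable _); apply/seteqP; split=> x /=; congr (lam n.+1 _ <= _)%E;
  by apply/seteqP; split => y; rewrite xsectionE.
Qed.

Lemma midpoint_lens (x z : rV) (r : R) : 0 < r -> enorm (x - z) < r ->
  ball (2^-1 *: (x + z)) (r / 2) `<=` ball x r `&` ball z r.
Proof.
move=> r0 xzr y; have r20 : 0 < r / 2 by rewrite divr_gt0.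
move=> /(ball_rVP _ _ r20) h; split; apply/ball_rVP => // i; have := h i;
  have := le_lt_trans (coor_le_enorm (x - z) i) xzr; rewrite !mxE !ltr_norml;
  by move=> /andP[h1 h2] /andP[h3 h4]; apply/andP; split; clear -h1 h2 h3 h4 r0; lra.
Qed.

(** On the piece A k the bad points fill at most a fraction 2^-(n+1) / 3 of
each ball of rational radius smaller than 1/(k+1). If x and z are two points
of A k at distance rho, the balls of a radius between rho and 2 rho around
them share a ball that the bad points of x and z cannot fill; a point y that
is good for both gives the Lipschitz bound for x and z. Rational radii make A
k a countable intersection. *)
Lemma rV_flat_of_zero_adiff (u : rV -> R) (Q : set rV) :
  measurable_fun setT u -> measurable Q ->
  {ae lam n.+1, forall x, Q x -> adiff u x (fun=> 0%R)} -> rV_flat_on Q u.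
Proof.
move=> mfu mQ aeQ eps eps0.
(* two steps, each of Euclidean length at most (n+1) 2 rho *)
pose e := eps / (4 * n.+1%:R).
have e0 : 0 < e by rewrite divr_gt0// mulr_gt0.
pose A k := [set x | forall q : rat, 0 < (ratr q : R) < k.+1%:R^-1 ->
  (lam n.+1 (defect u (fun=> 0%R) e x `&` ball x (ratr q)) <=
    ((ratr q) ^+ n.+1 / 3)%:E)%E].
pose del k : R := (2 * k.+1%:R)^-1.
have mA k : measurable (A k).
  rewrite (_ : A k = ~` \bigcup_q ~` [set x | 0 < (ratr q : R) < k.+1%:R^-1 ->
    (lam n.+1 (defect u (fun=> 0%R) e x `&` ball x (ratr q)) <=
    ((ratr q) ^+ n.+1 / 3)%:E)%E]).
    apply: measurableC; apply: bigcupT_measurable_rat => q; apply: measurableC.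
    have [hq|hq] := boolP (0 < (ratr q : R) < k.+1%:R^-1).
      rewrite (_ : [set _ | _] = [set x | (lam n.+1 (defect u (fun=> 0%R) e x `&` ball x (ratr q)) <=
        ((ratr q) ^+ n.+1 / 3)%:E)%E]).
        by apply: measurable_defect_ball => //; case/andP: hq.
      by apply/seteqP; split => x /=; [exact|].
    by rewrite (_ : [set _ | _] = setT)//; apply/seteqP; split.
  rewrite setC_bigcup; apply/seteqP; split => [x h q _|x h q].
    by rewrite setCK; exact: h.
  by have := h q I; rewrite setCK.
exists A, del; split => //.
- move=> k m km; apply/subsetPset => x h q /andP[q0 qm]; apply: h; rewrite q0/=.
  by apply: (lt_le_trans qm); rewrite lef_pV2 ?posrE// ler_nat.
- by move=> k; rewrite invr_gt0 mulr_gt0.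
- move=> k x z Ax Az xz.
  have [xzE|xz0] := eqVneq (enorm (x - z)) 0.
    by move/enorm_eq0 : xzE => /subr0_eq ->; rewrite !subrr normr0 enorm0 mulr0.
  have rho0 : 0 < enorm (x - z) by rewrite lt_neqAle eq_sym xz0 enorm_ge0.
  set rho := enorm (x - z) in xz xz0 rho0 *.
  have /rat_in_itvoo[q] : rho < 2 * rho by lra.
  rewrite in_itv/= => /andP[rq q2].
  have q0 : 0 < ratr q :> R by exact: lt_trans rq.
  have qk : 0 < (ratr q : R) < k.+1%:R^-1.
    rewrite q0/=; apply: (lt_trans q2); move: xz; rewrite /del invfM.
    by rewrite mulrC ltr_pdivlMr// mulrC.
  have [y [[yx yz] [nDx nDz]]] : exists y, (ball x (ratr q) y /\ ball z (ratr q) y) /\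
      (~ defect u (fun=> 0%R) e x y /\ ~ defect u (fun=> 0%R) e z y).
    apply: contrapT => /forallNP none.
    pose B := ball (2^-1 *: (x + z)) (ratr q / 2).
    have mdef v : measurable (defect u (fun=> 0%R) e v `&` ball v (ratr q)).
      apply: measurableI; last exact: measurable_ball_rV.
      exact: (measurable_defect (\0 : {linear rV -> R^o})).
    have BD : B `<=` (defect u (fun=> 0%R) e x `&` ball x (ratr q)) `|`
        (defect u (fun=> 0%R) e z `&` ball z (ratr q)).
      move=> y /(midpoint_lens q0 rq)[yx yz].
      have [Dx|nDx] := pselect (defect u (fun=> 0%R) e x y); first by left.
      have [Dz|nDz] := pselect (defect u (fun=> 0%R) e z y); first by right.
      by exfalso; apply: (none y).
    have : (lam n.+1 B <= ((ratr q) ^+ n.+1 / 3)%:E + ((ratr q) ^+ n.+1 / 3)%:E)%E.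
      apply: le_trans (leeD (Ax q qk) (Az q qk)).
      apply: le_trans (measureU2 _ (mdef x) (mdef z)).
      by apply: le_measure; rewrite ?inE//; [exact: measurable_ball_rV|exact: measurableU].
    rewrite (rV_lebesgue_ball _ (divr_gt0 q0 (ltr0Sn R 1))) -EFinD lee_fin.
    have -> : ratr q / 2 *+ 2 = ratr q :> R by rewrite -[LHS]mulr_natr divfK.
    by rewrite leNgt => /negP; apply; have := exprn_gt0 n.+1 q0; lra.
  have enb v : ball v (ratr q) y -> enorm (y - v) <= n.+1%:R * ratr q.
    move=> /(ball_rVP _ _ q0) h; apply: enorm_le_coor; first exact: ltW.
    by move=> i; have := h i; rewrite !mxE distrC => /ltW.
  have bnd v : ball v (ratr q) y -> ~ defect u (fun=> 0%R) e v y ->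
      `|u y - u v| <= e * (n.+1%:R * (2 * rho)).
    move=> yv /negP; rewrite -leNgt subr0 => /le_trans; apply.
    rewrite ler_pM2l//; apply: (le_trans (enb _ yv)).
    by rewrite ler_pM2l// ltW.
  apply: (le_trans (ler_distD (u y) _ _)).
  rewrite [`|u x - u y|]distrC.
  apply: (le_trans (lerD (bnd _ yx nDx) (bnd _ yz nDz))).
  rewrite le_eqVlt; apply/orP; left; apply/eqP; rewrite /e; field.
  by rewrite nat1r pnatr_eq0.
- have mN : measurable (Q `\` \bigcup_k A k).
    by apply: measurableD => //; exact: bigcupT_measurable.
  apply/negligibleP => //; apply: negligibleS aeQ => x [Qx nA] /= h.
  have i3 : 0 < 3^-1 :> R by rewrite invr_gt0.
  apply: nA; have [r0 r00 Hr] := h Qx e 3^-1 e0 i3.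
  have [k _ Hk] := near_natSinv_lt r00.
  exists k => // q /andP[q0 qk].
  rewrite mulrC; apply: Hr; rewrite q0/=; apply: lt_trans qk _.
  exact: Hk k (leqnn k).
Qed.

End zero_differential.

(** * From local to global constancy *)

Section local_to_global.
Context {R : realType} (n : nat).
Local Notation mu := (@lebesgue_measure R).
Local Notation lam := (@rV_lebesgue R).
Local Notation rV := 'rV[R]_n.+1.

Definition ae_value (u : rV -> R) (Q : set rV) (c : R) : Prop :=
  lam n.+1 (Q `&` [set x | u x != c]) = 0%E.

Lemma measurable_neq (u : rV -> R) (Q : set rV) (c : R) :
  measurable_fun setT u -> measurable Q -> measurable (Q `&` [set x | u x != c]).
Proof.
move=> mfu mQ; apply: measurableI => //.
rewrite (_ : [set _ | _] = u @^-1` (~` [set c])).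
  by rewrite -[X in measurable X]setTI; apply: mfu => //; exact: measurableC.
by apply/seteqP; split => x /= /eqP.
Qed.

Lemma ae_valueS u (Q Q' : set rV) c : measurable_fun setT u ->
  measurable Q -> measurable Q' -> Q' `<=` Q -> ae_value u Q c -> ae_value u Q' c.
Proof.
move=> mfu mQ mQ' QQ' h; apply/eqP; rewrite eq_le measure_ge0 andbT -h.
apply: le_measure; rewrite ?inE; [exact: measurable_neq|exact: measurable_neq|].
exact: setSI.
Qed.

Lemma ae_value_unique u (p : rV) (r : R) c c' : measurable_fun setT u -> 0 < r ->
  ae_value u (ball p r) c -> ae_value u (ball p r) c' -> c = c'.
Proof.
move=> mfu r0 hc hc'; apply: contrapT => /eqP cc'.
have mB := measurable_ball_rV p r.
have : (lam n.+1 (ball p r) <= 0)%E.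
  rewrite -[X in (_ <= X)%E]adde0 -{1}hc -hc'.
  apply: le_trans (measureU2 _ (measurable_neq _ mfu mB) (measurable_neq _ mfu mB)).
  apply: le_measure; rewrite ?inE//.
    by apply: measurableU; exact: measurable_neq.
  move=> y By; have [yc|yc] := eqVneq (u y) c; last by left.
  by right; split => //=; rewrite yc.
by rewrite rV_lebesgue_ball// lee_fin leNgt exprn_gt0// mulrn_wgt0.
Qed.

Lemma ae_value_of_pairs u (Q : set rV) : measurable_fun setT u -> measurable Q ->
  (\int[lam n.+1]_x \int[lam n.+1]_y (\1_(differ u Q) (x, y))%:E = 0)%E ->
  exists c, ae_value u Q c.
Proof.
move=> mfu mQ h.
have mD := measurable_differ mfu mQ.
have mI : measurable_fun setT (fun p : rV * rV => (\1_(differ u Q) p)%:E : \bar R).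
  by apply/measurable_EFinP; apply: measurable_indic.
have I0 p : (0 <= (\1_(differ u Q) p)%:E :> \bar R)%E by rewrite lee_fin.
have mF := measurable_fun_fubini_tonelli_F (m2 := lam n.+1) _ mI I0.
have F0 x : (0 <= \int[lam n.+1]_y (\1_(differ u Q) (x, y))%:E)%E by exact: integral_ge0.
have [N [mN N0 HN]] := (ge0_integral0_ae _ mF F0).1 h.
have [[x [Qx Nx]]|none] := pselect (exists x, Q x /\ ~ N x).
  exists (u x).
  have : (\int[lam n.+1]_y (\1_(differ u Q) (x, y))%:E = 0)%E.
    by apply: contrapT => hx; apply: Nx; exact: HN.
  rewrite /ae_value -[X in lam n.+1 X]setIT -integral_indic//; last exact: measurable_neq.
  move=> h2; apply: etrans h2; apply: eq_integral => y _; congr (_%:E).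
  rewrite !indicE; congr (_%:R); congr nat_of_bool; apply/idP/idP; rewrite !inE.
    by move=> [Qy /= yx]; split => //=; rewrite eq_sym.
  by move=> [/= _ Qy xy]; split => //=; rewrite eq_sym.
exists 0; apply/eqP; rewrite eq_le measure_ge0 andbT -N0.
apply: le_measure; rewrite ?inE//; first exact: measurable_neq.
by move=> x [Qx _]; apply: contrapT => Nx; apply: none; exists x.
Qed.

Lemma ae_value_cover u (Omega : set rV) c : measurable_fun setT u -> open Omega ->
  (forall p, Omega p -> exists2 r, 0 < r & ae_value u (ball p r) c) ->
  ae_value u Omega c.
Proof.
move=> mfu oO loc; have mO := open_measurable_rV oO.
pose F (k : nat) : set rV :=
  if @unpickle ('rV[rat]_n.+1 * nat)%type k is Some p then
    (if `[< ae_value u (rat_ball p) c >] then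
      rat_ball p `&` [set x | u x != c] else set0)
  else set0.
apply/negligibleP; first exact: measurable_neq.
apply: (@negligibleS _ _ _ _ (\bigcup_k F k)).
  move=> x [Ox ux]; have [r r0 hr] := loc x Ox.
  have [p [px pr]] := rat_ball_nbhs x r0.
  exists (pickle p); first exact: I.
  rewrite /F pickleK ifT//; apply/asboolP.
  by apply: ae_valueS hr => //; exact: measurable_ball_rV.
apply: negligible_bigcup => k; rewrite /F.
case: (unpickle k) => [p|]; last exact: negligible_set0.
case: ifPn => [/asboolP h|_]; last exact: negligible_set0.
apply/negligibleP => //; apply: measurable_neq => //; exact: measurable_ball_rV.
Qed.

(** The points near which c is the value are open in Omega; so are the others,
because the value on a small ball is unique. *)
Lemma ae_value_connected u (Omega : set rV) : measurable_fun setT u ->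
  open Omega -> connected Omega ->
  (forall p, Omega p -> exists2 r, 0 < r &
    ball p r `<=` Omega /\ exists c, ae_value u (ball p r) c) ->
  exists c, ae_value u Omega c.
Proof.
move=> mfu oO cO loc.
have [->|/set0P[p0 Op0]] := eqVneq Omega set0.
  by exists 0; rewrite /ae_value set0I measure0.
have [r0 r00 [_ [c hc]]] := loc p0 Op0.
exists c; apply: ae_value_cover => //.
pose V : set rV := [set p | Omega p /\ exists2 r, 0 < r & ae_value u (ball p r) c].
have sub_ball (p q : rV) (r : R) : ball p r q -> exists2 r', 0 < r' & ball q r' `<=` ball p r.
  move=> pq; have r_gt0 : 0 < r by case: pq.
  have : nbhs q (ball p r).
    by apply: open_nbhs_nbhs; split => //; exact: ball_open.
  by rewrite -nbhs_ballE => -[r' /= r'0 h]; exists r'.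
have oV : open V.
  rewrite openE => p [Op [r r_gt0 hr]].
  have [R0 R00 [R0O _]] := loc p Op.
  rewrite /interior -nbhs_ballE; exists (Num.min r R0); first by rewrite /= lt_min r_gt0.
  move=> q pq; split; first by apply: R0O; apply: le_ball pq; rewrite ge_min lexx orbT.
  have mr : Num.min r R0 <= r by rewrite ge_min lexx.
  have [r' r'0 h] := sub_ball p q r (le_ball mr pq).
  exists r'; first exact: r'0.
  exact: (ae_valueS mfu (measurable_ball_rV _ _) (measurable_ball_rV _ _) h hr).
have oW : open (Omega `\` V).
  rewrite openE => p [Op nVp].
  have [r r_gt0 [rO [c' hc']]] := loc p Op.
  rewrite /interior -nbhs_ballE; exists r; first exact: r_gt0.
  move=> q pq; split; first exact: rO.
  move=> [_ [r1 r10 h1]]; apply: nVp; split; first exact: Op.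
  exists r; first exact: r_gt0.
  suff <- : c' = c by [].
  have [r2 r20 h2] := sub_ball p q r pq.
  have m0 : 0 < Num.min r1 r2 by rewrite lt_min r10.
  apply: (ae_value_unique mfu m0).
    apply: (ae_valueS mfu (measurable_ball_rV _ _) (measurable_ball_rV _ _) _ hc').
    by apply: subset_trans h2; apply: le_ball; rewrite ge_min lexx orbT.
  apply: (ae_valueS mfu (measurable_ball_rV _ _) (measurable_ball_rV _ _) _ h1).
  by apply: le_ball; rewrite ge_min lexx.
have VO : V = Omega.
  apply: cO.
  - by exists p0; split; [exact: Op0|exists r0; [exact: r00|exact: hc]].
  - by exists V => //; apply/seteqP; split => [p []|p []].
  - exists (~` (Omega `\` V)); first exact: open_closedC.
    apply/seteqP; split => [p Vp|p [Op h]].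
      by split; [case: Vp|move=> []].
    by apply: contrapT => nV; apply: h.
by move=> p; rewrite -VO => -[].
Qed.

End local_to_global.

Section borel_theorem.
Context {R : realType} (n : nat).
Local Notation mu := (@lebesgue_measure R).
Local Notation lam := (@rV_lebesgue R).
Local Notation rV := 'rV[R]_n.+1.
Variables (om : R -> R).
Hypotheses (om0 : forall x, 0 <= om x) (com : continuous om).
Hypothesis om_gt0 : forall x, 0 < x -> 0 < om x.
Hypothesis om_int : (\int[mu]_(m in `[1%R, +oo[) (om m / m ^+ 2)%:E = +oo)%E.

Lemma ball_line_convex (p : rV) (r : R) : line_convex (ball p r).
Proof.
move=> z c s t q Bs Bt /andP[sq qt]; have r0 : 0 < r by case: Bs.
move: Bs Bt => /(ball_rVP _ _ r0) hs /(ball_rVP _ _ r0) ht.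
apply/ball_rVP => // i; have := hs i; have := ht i.
rewrite /line; case: (unliftP ord0 i) => [j ->|->]; rewrite ?rV_consS ?rV_cons0 ?mxE.
  rewrite !ltr_norml => /andP[h1 h2] /andP[h3 h4].
  have [z0|z0] := leP 0 (z ord0 j).
    have := ler_wpM2r z0 sq; have := ler_wpM2r z0 qt.
    by move=> h5 h6; apply/andP; split; clear -h1 h2 h3 h4 h5 h6; lra.
  have := ler_wnM2r (ltW z0) sq; have := ler_wnM2r (ltW z0) qt.
  by move=> h5 h6; apply/andP; split; clear -h1 h2 h3 h4 h5 h6; lra.
rewrite /= !ltr_norml => /andP[h1 h2] /andP[h3 h4].
by apply/andP; split; clear -h1 h2 h3 h4 sq qt; lra.
Qed.

Lemma borel_finite_energy (u : rV -> R) (M : R) (Omega : set rV) :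
  measurable_fun setT u -> (forall x, `|u x| <= M) -> open Omega -> connected Omega ->
  {ae lam n.+1, forall x, Omega x -> exists L : {linear rV -> R^o}, adiff u x L} ->
  (\int[lam n.+1]_x \int[lam n.+1]_y energy_kernel om u Omega (x, y) < +oo)%E ->
  exists c, ae_value u Omega c.
Proof.
move=> mfu uM oO cO aed fin.
have mO := open_measurable_rV oO.
have mE (Q : set rV) : measurable Q -> measurable_fun setT (energy_kernel om u Q).
  exact: measurable_energy_kernel.
have E0 (Q : set rV) z : (0 <= energy_kernel om u Q z)%E by exact: energy_kernel_ge0.
have mEF Q (mQ : measurable Q) := measurable_fun_fubini_tonelli_F (m2 := lam n.+1) _ (mE Q mQ) (E0 Q).
have EF0 Q x : (0 <= \int[lam n.+1]_y energy_kernel om u Q (x, y))%E.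
  by apply: integral_ge0 => y _; exact: E0.
have aefin := ge0_integral_lty_ae (mEF _ mO) (EF0 Omega) fin.
have aed0 : {ae lam n.+1, forall x, Omega x -> adiff u x (fun=> 0)}.
  apply: (@filterS2 _ _ (ae_filter_ringOfSetsType (lam n.+1)) _ _ _ _ aed aefin) => x Hd Hf Ox.
  have [L dL] := Hd Ox.
  suff -> : (fun=> 0) = (L : rV -> R) by [].
  apply/funext => e; apply/esym/eqP/negPn/negP => Le.
  have := nonzero_differential_infinite om0 com om_gt0 mfu oO Ox Le dL.
  by move: Hf => /[swap]; rewrite /fubini_F => ->; rewrite ltxx.
apply: ae_value_connected => // p Op.
have := open_nbhs_nbhs (conj oO Op); rewrite -nbhs_ballE => -[r /= r0 rO].
exists r => //; split => //.
have mB := measurable_ball_rV p r.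
apply: ae_value_of_pairs => //.
apply: (finite_energy_pairs om0 com om_gt0 om_int mfu mB
    (@ball_line_convex p r) (M := M)).
- by move=> x _; exact: uM.
- apply: (rV_flat_of_zero_adiff mfu mB).
  by apply: (@filterS _ _ (ae_filter_ringOfSetsType (lam n.+1)) _ _ _ aed0) => x h /rO; exact: h.
apply: le_lt_trans fin.
apply: ge0_le_integral; [exact: measurableT| | | |].
- by move=> x _; exact: EF0.
- exact: (mEF _ mB).
- exact: (mEF _ mO).
move=> x _; apply: ge0_le_integral; [exact: measurableT| | | |].
- by move=> y _; exact: E0.
- exact: (measurable_fun_pair2 x (mE _ mB)).
- exact: (measurable_fun_pair2 x (mE _ mO)).
move=> y _; rewrite lee_fin; apply: ler_wpM2l.
  by rewrite mulr_ge0// invr_ge0 exprn_ge0// enorm_ge0.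
have indS v : \1_(ball p r) v <= \1_Omega v :> R.
  rewrite !indicE ler_nat; have [h|h] := pselect (ball p r v).
    by rewrite !mem_set//; exact: rO.
  by rewrite (memNset h).
exact: ler_pM.
Qed.

End borel_theorem.

(** * Borel representatives of Lebesgue measurable objects *)

Section completion.
Local Open Scope ereal_scope.
Context d (T : measurableType d) (R : realType).
Variable m : {sigma_finite_measure set T -> \bar R}.
Local Notation cm := (@completed_measure_extension _ _ _ m).
Local Notation cT := (caratheodory_type (m^*)%mu).

Lemma completion_measurable (A : set T) : measurable A -> measurable (A : set cT).
Proof. exact: caratheodory_measurable_mu_ext. Qed.

Lemma completionE (A : set T) : measurable A -> cm A = m A.
Proof. exact: measurable_mu_extE. Qed.

(** Intersect countable Borel covers whose total measures approach the outer
measure. *)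
Lemma completion_hull (X : set T) : cm X < +oo ->
  exists F : set T, [/\ measurable F, X `<=` F & m F = cm X].
Proof.
move=> Xfin.
have fX : cm X \is a fin_num by rewrite ge0_fin_numE//; exact: outer_measure_ge0.
have inv0 k : (0 < k.+1%:R^-1 :> R)%R by rewrite invr_gt0.
have cover k : {A : (set T)^nat | measurable_cover X A &
    \sum_(0 <= i <oo) m (A i) < cm X + k.+1%:R^-1%:E}.
  apply: cid2; have := lb_ereal_inf_adherent (inv0 k) fX.
  by move=> [_ /= [A cA <-] ?]; exists A.
pose A k := s2val (cover k).
have mA k i : measurable (A k i) by have [h _] := s2valP (cover k); exact: h.
pose U k := \bigcup_i A k i.
have mU k : measurable (U k) by exact: bigcupT_measurable.
have XU k : X `<=` U k by have [_ h] := s2valP (cover k); exact: h.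
have Ule k : m (U k) <= cm X + k.+1%:R^-1%:E.
  apply: le_trans (ltW (s2valP' (cover k))).
  exact: (measure_sigma_subadditive m (mA k) (mU k) (@subset_refl _ _)).
exists (\bigcap_k U k); split.
- exact: bigcapT_measurable.
- by move=> x Xx k _; exact: XU.
have mF : measurable (\bigcap_k U k) by exact: bigcapT_measurable.
apply/eqP; rewrite eq_le; apply/andP; split; last first.
  by rewrite -(completionE mF); apply: le_outer_measure => x Xx k _; exact: XU.
apply/lee_addgt0Pr => e e0.
have [k _ Hk] := near_infty_natSinv_lt (PosNum e0).
have {}Hk := Hk k (leqnn k).
apply: (@le_trans _ _ (m (U k))).
  by apply: le_measure; rewrite ?inE// => x; exact.
by apply: le_trans (Ule k) _; rewrite leeD2l// lee_fin ltW.
Qed.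

Lemma completion_null_hull (X : set T) : cm X = 0 ->
  exists N : set T, [/\ measurable N, X `<=` N & m N = 0].
Proof.
move=> X0; have : cm X < +oo by rewrite X0 ltry.
by move=> /completion_hull[F [mF XF FX]]; exists F; rewrite FX X0.
Qed.

Lemma completion_negligible (X : set T) : cm.-negligible (X : set cT) ->
  exists N : set T, [/\ measurable N, X `<=` N & m N = 0].
Proof.
move=> [A [mA A0 XA]]; have [N [mN AN N0]] := completion_null_hull A0.
by exists N; split => //; exact: subset_trans AN.
Qed.

Lemma null_bigcup (F : (set T)^nat) : (forall k, measurable (F k)) ->
  (forall k, m (F k) = 0) -> m (\bigcup_k F k) = 0.
Proof.
move=> mF F0; apply/negligibleP; first exact: bigcupT_measurable.
apply: negligible_bigcup => k; apply/negligibleP; [exact: mF|exact: F0].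
Qed.

(** Cut E into pieces of finite measure; each has a Borel hull of the same
outer measure, and the differences have Borel null hulls. *)
Lemma completion_borel (E : set T) : measurable (E : set cT) ->
  exists B N : set T, [/\ measurable B, measurable N, m N = 0 &
    forall x, ~ N x -> E x <-> B x].
Proof.
move=> mE.
have /sigma_finiteP[S [TS ndS Sfin]] := sigma_finiteT m.
have mES i : measurable (E `&` S i : set cT).
  by apply: measurableI => //; apply: completion_measurable; exact: (Sfin i).1.
have hull i : {p : set T * set T | [/\ measurable p.1, measurable p.2, m p.2 = 0,
    E `&` S i `<=` p.1 & p.1 `\` (E `&` S i) `<=` p.2]}.
  apply: cid.
  have ESfin : cm (E `&` S i) < +oo.
    have cS : cm (S i) < +oo by rewrite completionE; [exact: (Sfin i).2|exact: (Sfin i).1].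
    by apply: le_lt_trans cS; apply: le_outer_measure; exact: subIsetr.
  have [F [mF EF FE]] := completion_hull ESfin.
  have D0 : cm (F `\` (E `&` S i)) = 0.
    have mFc := completion_measurable mF.
    have cmF : cm F < +oo by rewrite (completionE mF) FE.
    have H := @measureD _ _ _ cm _ _ mFc (mES i).
    transitivity (cm F - cm (F `&` (E `&` S i))).
      by apply: H; exact: cmF.
    have fE : cm (E `&` S i) \is a fin_num by rewrite ge0_fin_numE//; exact: outer_measure_ge0.
    by rewrite (setIidr EF) (completionE mF) FE subee.
  have [N [mN DN N0]] := completion_null_hull D0.
  by exists (F, N).
pose F i := (projT1 (hull i)).1; pose N i := (projT1 (hull i)).2.
have HP i : [/\ measurable (F i), measurable (N i), m (N i) = 0,
    E `&` S i `<=` F i & F i `\` (E `&` S i) `<=` N i] by exact: (projT2 (hull i)).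
exists (\bigcup_i F i), (\bigcup_i N i); split.
- by apply: bigcupT_measurable => i; have [] := HP i.
- by apply: bigcupT_measurable => i; have [] := HP i.
- by apply: null_bigcup => i; have [] := HP i.
move=> x nN; split.
  move=> Ex; have [i _ Sx] : (\bigcup_i S i) x by rewrite -TS.
  by exists i => //; have [_ _ _ + _] := HP i; apply.
move=> [i _ Fx]; apply: contrapT => nE; apply: nN; exists i => //.
by have [_ _ _ _] := HP i; apply; split => // -[].
Qed.

(** It is enough to correct the countably many level sets at rational levels.
*)
Lemma completion_fun_borel (D : set T) (u : T -> R) :
  measurable D -> measurable_fun (D : set cT) (u : cT -> R) ->
  exists N : set T, [/\ measurable N, m N = 0 & measurable_fun (D `\` N) u].
Proof.
move=> mD mu_.
have level (q : rat) : {p : set T * set T | [/\ measurable p.1, measurable p.2, m p.2 = 0 &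
    forall x, ~ p.2 x -> (D `&` [set x | ratr q < u x]%R) x <-> p.1 x]}.
  apply: cid.
  have mE : measurable (D `&` [set x | ratr q < u x]%R : set cT).
    rewrite -preimage_itvoy; apply: mu_ => //; exact: completion_measurable.
  by have [B [N [mB mN N0 BN]]] := completion_borel mE; exists (B, N).
pose B q := (projT1 (level q)).1; pose N q := (projT1 (level q)).2.
have LP q : [/\ measurable (B q), measurable (N q), m (N q) = 0 &
    forall x, ~ N q x -> (D `&` [set x | ratr q < u x]%R) x <-> B q x].
  exact: (projT2 (level q)).
pose F (k : nat) := if @unpickle rat k is Some q then N q else set0.
have mF k : measurable (F k).
  by rewrite /F; case: unpickle => [q|]//; have [] := LP q.
have NF q : N q `<=` \bigcup_k F k.
  by move=> x Nx; exists (pickle q); [exact: I|by rewrite /F pickleK].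
exists (\bigcup_k F k); split.
- exact: bigcupT_measurable.
- apply: null_bigcup => // k; rewrite /F; case: unpickle => [q|]; last exact: measure0.
  by have [] := LP q.
have mN : measurable (\bigcup_k F k) by exact: bigcupT_measurable.
move=> mDN; apply: (measurability _ (RGenOInfty.measurableE R)) => //.
move=> /= _ [_ [a ->] <-]; rewrite preimage_itvoy.
rewrite [X in measurable X](_ : _ = \bigcup_(q : rat)
    (if (a < ratr q)%R then (D `\` \bigcup_k F k) `&` B q else set0)).
  apply: bigcupT_measurable_rat => q; case: ifP => // _.
  by apply: measurableI => //; have [] := LP q.
apply/seteqP; split => [x [[Dx nFx] /= ax]|x [q _]].
  have /rat_in_itvoo[q] := ax; rewrite in_itv/= => /andP[aq qu].
  exists q => //; rewrite aq; split; first by split.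
  have [_ _ _ h] := LP q; apply/h; last by split.
  by move=> Nx; apply: nFx; exact: NF Nx.
case: ifPn => // aq [[Dx nFx] Bx]; split; first by split.
have [_ _ _ h] := LP q.
have [_ /= qu] := (h x (fun Nx => nFx (NF q x Nx))).2 Bx.
exact: lt_trans aq qu.
Qed.

Lemma completion_ae (P : T -> Prop) : {ae cm, forall x : cT, P x} ->
  exists N : set T, [/\ measurable N, m N = 0 & forall x, ~ N x -> P x].
Proof.
move=> /completion_negligible[N [mN PN N0]]; exists N; split => // x nN.
by apply: contrapT => nP; apply: nN; exact: PN.
Qed.

End completion.

(** * Transfer between Lebesgue and Borel measures *)

Section transfer.
Context {R : realType} (n : nat).
Local Notation lam := (@rV_lebesgue R).
Local Notation rV := 'rV[R]_n.+1.

Lemma eball_sub_ball (x : rV) (r : R) : 0 < r -> eball x r `<=` ball x r.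
Proof.
move=> r0 y yx; apply/ball_rVP => // i; apply: le_lt_trans yx.
by have := coor_le_enorm (y - x) i; rewrite !mxE distrC.
Qed.

Lemma ball_sub_eball (x : rV) (r s : R) : 0 < r -> n.+1%:R * r < s -> ball x r `<=` eball x s.
Proof.
move=> r0 rs y /(ball_rVP _ _ r0) h; apply: le_lt_trans rs.
apply: enorm_le_coor; first exact: ltW.
by move=> i; have := h i; rewrite !mxE distrC => /ltW.
Qed.

Lemma leb_borel (A : set rV) : measurable A -> leb A = lam n.+1 A.
Proof. exact: completionE. Qed.

Lemma le_leb (A B : set rV) : A `<=` B -> (leb A <= leb B)%E.
Proof. exact: le_outer_measure. Qed.

Lemma leb_ge0 (A : set rV) : (0 <= leb A)%E.
Proof. exact: outer_measure_ge0. Qed.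

Lemma leb_eball (x : rV) (r : R) : 0 < r ->
  ((0 < leb (eball x r)) /\ (leb (eball x r) <= ((r *+ 2) ^+ n.+1)%:E))%E.
Proof.
move=> r0; split; last first.
  rewrite -(rV_lebesgue_ball x r0) -leb_borel; last exact: measurable_ball_rV.
  by apply: le_leb; exact: eball_sub_ball.
pose s := r / (2 * n.+1%:R).
have s0 : 0 < s by rewrite divr_gt0// mulr_gt0.
have sr : n.+1%:R * s < r.
  have -> : n.+1%:R * s = r / 2 by rewrite /s; field; rewrite nat1r pnatr_eq0.
  by rewrite ltr_pdivrMr// ltr_pMr// ltr1n.
apply: lt_le_trans (le_leb (ball_sub_eball s0 sr)).
rewrite leb_borel; last exact: measurable_ball_rV.
by rewrite rV_lebesgue_ball// lte_fin exprn_gt0// mulrn_wgt0.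
Qed.

(** The real form of the definition, which divides in the extended reals; this
is legitimate because the ball has positive finite measure. *)
Lemma density0P (E : set rV) (x : rV) (eta : R) : density0 E x -> 0 < eta ->
  exists2 r0, 0 < r0 & forall r, 0 < r < r0 ->
    (leb (E `&` eball x r) <= (eta * (r *+ 2) ^+ n.+1)%:E)%E.
Proof.
move=> dens eta0.
have := dens [set y : \bar R | (y < eta%:E)%E].
case; first by apply: (@open_ereal_lt' R 0%E eta%:E); rewrite lte_fin.
move=> r0 /= r00 H.
exists r0 => // r /andP[rgt rlt].
have := H r; rewrite /ball_/= sub0r normrN gtr0_norm// => /(_ rlt rgt).
have [b0 b1] := leb_eball x rgt.
set b := leb (eball x r) in b0 b1 *.
have bfin : b \is a fin_num by rewrite gt0_fin_numE// (le_lt_trans b1)// ltry.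
have Efin : leb (E `&` eball x r) \is a fin_num.
  rewrite ge0_fin_numE ?leb_ge0//; apply: (@le_lt_trans _ _ b).
    by apply: le_leb; exact: subIsetr.
  by rewrite (le_lt_trans b1)// ltry.
rewrite -(fineK bfin) lte_fin in b0; rewrite -(fineK bfin) lee_fin in b1.
rewrite -(fineK bfin) -(fineK Efin) inver gt_eqF// -EFinM lte_fin ltr_pdivrMr//.
move=> /ltW h; rewrite lee_fin (le_trans h)// ler_wpM2l// ltW//.
Qed.

(** Near x, the points where v is far from its affine approximation are such
points for u, up to the null set N. The ball of radius r is contained in the
Euclidean ball of radius 2 (n+1) r. *)
Lemma adiff_of_approx (u v : rV -> R) (Omega N : set rV) (x : rV)
    (L : {linear rV -> R^o}) :
  open Omega -> Omega x -> measurable N -> lam n.+1 N = 0%E -> ~ N x ->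
  measurable_fun setT v -> (forall y, Omega y -> ~ N y -> v y = u y) ->
  (forall eps : R, 0 < eps ->
    density0 [set y | Omega y /\
                      eps * enorm (y - x) < `|u y - u x - L (y - x)|] x) ->
  adiff v x L.
Proof.
move=> oO Ox mN N0 nNx mv vu dens eps eta eps0 eta0.
pose E e := [set y | Omega y /\ e * enorm (y - x) < `|u y - u x - L (y - x)|].
pose D : R := 2 * n.+1%:R.
have D0 : 0 < D by rewrite mulr_gt0.
have eta'0 : 0 < eta / (D *+ 2) ^+ n.+1 by rewrite divr_gt0// exprn_gt0// mulrn_wgt0.
have [r0 r00 Hr] := @density0P (E eps) x _ (dens _ eps0) eta'0.
have := open_nbhs_nbhs (conj oO Ox); rewrite -nbhs_ballE => -[r1 /= r10 r1O].
exists (Num.min (r0 / D) r1); first by rewrite lt_min r10 divr_gt0.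
move=> r /andP[rgt]; rewrite lt_min => /andP[rr0 rr1].
have mdef : measurable (defect v L eps x `&` ball x r).
  by apply: measurableI; [exact: measurable_defect|exact: measurable_ball_rV].
rewrite -leb_borel//.
have Dr : 0 < D * r < r0 by rewrite mulr_gt0//= mulrC -ltr_pdivlMr.
apply: (@le_trans _ _ (leb ((E eps `&` eball x (D * r)) `|` N))).
  apply: le_leb => y [dy By].
  have [Ny|nNy] := pselect (N y); first by right.
  have Oy : Omega y by apply: r1O; apply: le_ball By; exact: ltW.
  left; split.
    by split => //; move: dy; rewrite /defect/= !vu.
  apply: (ball_sub_eball rgt) By.
  by rewrite /D -mulrA ltr_pMl ?mulr_gt0// ltr1n.
apply: (@le_trans _ _ (leb (E eps `&` eball x (D * r)) + leb N)%E).
  exact: outer_measureU2.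
rewrite (leb_borel mN) N0 adde0; apply: le_trans (Hr _ Dr) _.
have -> : (D * r) *+ 2 = (D *+ 2) * r by rewrite mulrnAl.
rewrite lee_fin [((D *+ 2) * r) ^+ _]exprMn mulrA divfK//.
by rewrite gt_eqF// exprn_gt0// mulrn_wgt0.
Qed.

End transfer.

Section nonmeasurable.
Local Open Scope ereal_scope.

(** The integral of a nonnegative function is a supremum over simple functions
below it, whence its monotonicity for arbitrary functions; it is applied to
the integrand of the energy as it was originally given. *)
Lemma ge0_le_integral_nomeas d (T : measurableType d) (R : realType)
    (m : {measure set T -> \bar R}) (f g : T -> \bar R) :
  (forall x, 0 <= f x) -> (forall x, f x <= g x) ->
  \int[m]_x f x <= \int[m]_x g x.
Proof.
move=> f0 fg; have g0 x : 0 <= g x by exact: le_trans (fg x).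
rewrite !ge0_integralTE//; apply: ge_ereal_sup => _ [h /= hf <-].
by apply: ereal_sup_ubound; exists h => // x; exact: le_trans (fg x).
Qed.

End nonmeasurable.

Section energy_transfer.
Context {R : realType} (n : nat).
Local Notation lam := (@rV_lebesgue R).
Local Notation rV := 'rV[R]_n.+1.

Lemma measurable_leb_id : measurable_fun [set: leb_rV R n.+1] (fun x : leb_rV R n.+1 => x : rV).
Proof.
by move=> _ Y mY; rewrite setTI; exact: completion_measurable.
Qed.

(** The identity, seen as a map from the product of the completed spaces to
the product of the Borel spaces, which carries the one product measure to the
other. *)
Definition lebpair_id (z : leb_rV R n.+1 * leb_rV R n.+1) : rV * rV := z.

Lemma measurable_lebpair_id : measurable_fun setT lebpair_id.
Proof.
apply/measurable_fun_pairP; split.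
  exact: (measurableT_comp measurable_leb_id measurable_fst).
exact: (measurableT_comp measurable_leb_id measurable_snd).
Qed.

Lemma integral_lebpair (f : rV * rV -> \bar R) : measurable_fun setT f ->
  (forall z, 0 <= f z)%E ->
  (\int[@leb R n.+1 \x @leb R n.+1]_z f (lebpair_id z) =
   \int[lam n.+1]_x \int[lam n.+1]_y f (x, y))%E.
Proof.
move=> mf f0.
rewrite -(fubini_tonelli1 (m1 := lam n.+1) (m2 := lam n.+1) f mf f0).
pose pm := measure_function_pushforward__canonical__measure_function_Measure
  (@leb R n.+1 \x @leb R n.+1)%E measurable_lebpair_id.
have E X : measurable X -> (lam n.+1 \x lam n.+1)%E X = pm X.
  apply: product_measure_unique => A B mA mB.
  rewrite -(leb_borel mA) -(leb_borel mB).
  exact: (@product_measure1E _ _ _ _ R (@leb R n.+1) (@leb R n.+1) A B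
    (completion_measurable (lam n.+1) mA) (completion_measurable (lam n.+1) mB)).
transitivity (\int[pm]_z f z)%E; last first.
  by apply: eq_measure_integral => A mA _; apply/esym; exact: E.
rewrite [RHS](ge0_integral_pushforward measurable_lebpair_id)//.
Qed.

Lemma energy_kernel_ae (om : R -> R) (v : rV -> R) (Q Q' : set rV) (N : set rV) :
  continuous om -> (forall x, 0 <= om x) ->
  measurable_fun setT v -> measurable Q -> measurable Q' -> measurable N ->
  lam n.+1 N = 0%E -> (forall x, ~ N x -> Q x <-> Q' x) ->
  (\int[lam n.+1]_x \int[lam n.+1]_y energy_kernel om v Q (x, y) =
   \int[lam n.+1]_x \int[lam n.+1]_y energy_kernel om v Q' (x, y))%E.
Proof.
move=> com om0 mv mQ mQ' mN N0 QQ'.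
have mE P (mP : measurable P) := measurable_energy_kernel com mv mP.
have E0 P z : (0 <= energy_kernel om v P z)%E by exact: energy_kernel_ge0.
have EF0 P x : (0 <= \int[lam n.+1]_y energy_kernel om v P (x, y))%E.
  by apply: integral_ge0 => y _; exact: E0.
have mEF P (mP : measurable P) :=
  measurable_fun_fubini_tonelli_F (m2 := lam n.+1) _ (mE P mP) (E0 P).
have ind x : ~ N x -> \1_Q x = \1_Q' x :> R.
  move=> /QQ' h; rewrite !indicE; congr (_%:R); congr nat_of_bool.
  by apply/idP/idP; rewrite !inE => /h.
apply: ge0_ae_eq_integral; [exact: measurableT|exact: (mEF _ mQ)|exact: (mEF _ mQ')| | |].
- by move=> x _; exact: EF0.
- by move=> x _; exact: EF0.
exists N; split => // x /= h; apply: contrapT => nNx; apply: h => _.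
apply: ge0_ae_eq_integral; [exact: measurableT| | | | |].
- exact: (measurable_fun_pair2 x (mE _ mQ)).
- exact: (measurable_fun_pair2 x (mE _ mQ')).
- by move=> y _; exact: E0.
- by move=> y _; exact: E0.
exists N; split => // y /= h; apply: contrapT => nNy; apply: h => _.
by rewrite /energy_kernel /= !ind.
Qed.

End energy_transfer.

Section extension_of_omega.
Context {R : realType}.

(** The function omega is only given on [0, +oo[; composed with x |-> max 0 x
it becomes a continuous, hence measurable, function on the whole line. *)
Lemma continuous_clamp (omega : R -> R) :
  {within `[0, +oo[, continuous omega} -> continuous (fun x : R => omega (Num.max 0 x)).
Proof.
move=> /subspace_continuousP com x.
have mx : `[0, +oo[%classic (Num.max 0 x) by rewrite /= in_itv/= andbT le_max lexx.
have cmax : continuous (fun x : R => Num.max 0 x : R).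
  move=> y; apply: (@continuous_max R R (fun=> 0) id); first exact: cvg_cst.
  exact: cvg_id.
apply: (@cvg_comp _ _ _ (fun t : R => Num.max 0 t) omega _
  (within `[0, +oo[%classic (nbhs (Num.max 0 x))) _ _ (com _ mx)) => P KP.
have : \forall t \near x, `[0, +oo[%classic (Num.max 0 t) -> P (Num.max 0 t).
  exact: (cmax x _ KP).
apply: filterS => t; apply.
by rewrite /= in_itv/= andbT le_max lexx.
Qed.

Lemma Linfty_bound n (Omega : set 'rV[R]_n.+1) (u : 'rV[R]_n.+1 -> R) :
  Linfty Omega u -> exists2 M, 0 <= M &
    {ae @leb R n.+1, forall x, Omega x -> `|u x| <= M}.
Proof.
move=> [_]; rewrite unlock /=.
have pos : (0 < @leb R n.+1 setT)%E.
  apply: (@lt_le_trans _ _ (leb (eball (0 : 'rV[R]_n.+1) 1))).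
    by have [] := leb_eball (0 : 'rV[R]_n.+1) (@ltr01 R).
  exact: le_leb.
rewrite pos => fin.
have := ess_sup_ge (@leb R n.+1) (abse \o [eta EFin \o u \_ Omega]).
set e := ess_sup _ _ in fin *.
have [M M0 eM] : exists2 M : R, 0 <= M & (e <= M%:E)%E.
  case: e fin => [r _||_]; [|by rewrite ltxx|by exists 0; rewrite ?leNye].
  by exists (Num.max 0 r); rewrite ?lee_fin le_max lexx// orbT.
move=> h; exists M => //; move: h.
apply: (@filterS _ _ (ae_filter_ringOfSetsType (@leb R n.+1))) => x h Ox.
have := le_trans h eM.
by rewrite /= patchE mem_set// lee_fin.
Qed.

Lemma energy_infinite_succ (omega : R -> R)
    (omega_ge0 : forall m : R, 0 <= m -> 0 <= omega m)
    (omega_cont : {within `[0, +oo[, continuous omega})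
    (omega_gt0 : forall m : R, 0 < m -> 0 < omega m)
    (omega_int :
      (\int[@lebesgue_measure R]_(m in `[1%R, +oo[) (omega m / m ^+ 2)%:E
       = +oo)%E)
    (n : nat)
    (Omega : set 'rV[R]_n.+1) (Omega_open : open Omega)
    (Omega_connected : connected Omega)
    (u : 'rV[R]_n.+1 -> R) (u_Linfty : Linfty Omega u)
    (u_nonconst : ~ ess_constant Omega u)
    (u_diff : {ae @leb R n.+1, forall x, Omega x ->
                 approx_differentiable Omega u x}) :
  nonlocal_energy omega u Omega = +oo%E.
Proof.
apply: contrapT => /eqP; rewrite -ltey => fin; apply: u_nonconst.
pose om x := omega (Num.max 0 x).
have omE x : 0 <= x -> om x = omega x by move=> x0; rewrite /om max_r.
have om0 x : 0 <= om x by apply: omega_ge0; rewrite le_max lexx.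
have com : continuous om by exact: continuous_clamp.
have om_gt0 x : 0 < x -> 0 < om x by move=> x0; rewrite omE ?omega_gt0// ltW.
have om_int : (\int[@lebesgue_measure R]_(m in `[1%R, +oo[) (om m / m ^+ 2)%:E = +oo)%E.
  rewrite -[RHS]omega_int; apply: eq_integral => m.
  by rewrite inE/= in_itv/= andbT => m1; rewrite omE// (le_trans _ m1).
have mO := open_measurable_rV Omega_open.
have [mu_ _] := u_Linfty.
have [N1 [mN1 N10 mu1]] := completion_fun_borel mO mu_.
have [M M0 aeM] := Linfty_bound u_Linfty.
have [N2 [mN2 N20 HN2]] := completion_ae aeM.
have [N3 [mN3 N30 HN3]] := completion_ae u_diff.
(* outside N, the function u is Borel, bounded by M and approximately
   differentiable *)
pose N := N1 `|` N2 `|` N3.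
have mN : measurable N by apply: measurableU => //; exact: measurableU.
have N0 : rV_lebesgue n.+1 N = 0%E.
  apply/negligibleP => //; apply: negligibleU; last exact/negligibleP.
  by apply: negligibleU; exact/negligibleP.
pose G := Omega `\` N.
have mG : measurable G by exact: measurableD.
pose v x := if x \in G then u x else 0.
have vG x : G x -> v x = u x by move=> Gx; rewrite /v mem_set.
have mv : measurable_fun setT v.
  have -> : v = u \_ G by apply/funext => x; rewrite patchE.
  apply/(measurable_restrictT _ mG).
  apply: (measurable_funS _ _ mu1); first exact: measurableD.
  by move=> x [Ox nN]; split => // N1x; apply: nN; left; left.
have vM x : `|v x| <= M.
  rewrite /v; case: ifPn => [|_]; last by rewrite normr0.
  by rewrite inE => -[Ox nN]; apply: HN2 => // N2x; apply: nN; left; right.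
have aed : {ae rV_lebesgue n.+1, forall x, Omega x ->
    exists L : {linear 'rV[R]_n.+1 -> R^o}, adiff v x L}.
  exists N; split => // x /= /not_implyP[Ox h]; apply: contrapT => nN; apply: h.
  have [L HL] : approx_differentiable Omega u x.
    by apply: HN3 => // N3x; apply: nN; right.
  exists L; apply: (adiff_of_approx Omega_open Ox mN N0 nN mv _ HL).
  by move=> y Oy nNy; exact: vG.
have fin' : (\int[rV_lebesgue n.+1]_x \int[rV_lebesgue n.+1]_y
    energy_kernel om v Omega (x, y) < +oo)%E.
  rewrite (@energy_kernel_ae R n om v Omega G N)//; last first.
    by move=> x nN; split => [Ox|[]//]; split.
  rewrite -integral_lebpair; last 2 first.
  - exact: measurable_energy_kernel.
  - by move=> z; exact: energy_kernel_ge0.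
  apply: le_lt_trans fin; rewrite /nonlocal_energy [leRHS]integral_mkcond.
  apply: ge0_le_integral_nomeas => [z|[x y]]; first exact: energy_kernel_ge0.
  have arg0 : 0 <= `|u y - u x| / enorm (y - x) by rewrite divr_ge0// enorm_ge0.
  have rhs0 : (0 <= ((fun z : leb_rV R n.+1 * leb_rV R n.+1 =>
      (omega (`|u z.2 - u z.1| / enorm (z.2 - z.1)) *
         (enorm (z.2 - z.1) ^+ n.+1)^-1)%:E) \_ (Omega `*` Omega)) (x, y))%E.
    rewrite patchE; case: ifPn => // _; rewrite lee_fin mulr_ge0//.
      exact: omega_ge0.
    by rewrite invr_ge0 exprn_ge0// enorm_ge0.
  have [Gx|nGx] := pselect (G x); last first.
    by rewrite /energy_kernel /lebpair_id /= !indicE memNset// mul0r mulr0.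
  have [Gy|nGy] := pselect (G y); last first.
    by rewrite /energy_kernel /lebpair_id /= !indicE (memNset nGy) !mulr0.
  rewrite patchE mem_set; last by split; [case: Gx|case: Gy].
  by rewrite /energy_kernel /lebpair_id /= !indicE !mem_set// !mulr1 !vG// omE.
have [c hc] := borel_finite_energy om0 com om_gt0 om_int mv vM Omega_open
  Omega_connected aed fin'.
exists c; exists ((Omega `&` [set x | v x != c]) `|` N).
have mA : measurable (Omega `&` [set x | v x != c]) by exact: measurable_neq.
split.
- by apply: completion_measurable; exact: measurableU.
- rewrite -[LHS]/(leb _) leb_borel; last exact: measurableU.
  apply/negligibleP; first exact: measurableU.
  by apply: negligibleU; exact/negligibleP.
move=> x /= /not_implyP[Ox ux]; have [Nx|nNx] := pselect (N x); first by right.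
left; split => //=; apply/eqP; rewrite vG//; exact: ux.
Qed.

End extension_of_omega.

Theorem theorem1p3 (R : realType) (omega : R -> R)
    (omega_ge0 : forall m : R, 0 <= m -> 0 <= omega m)
    (omega_cont : {within `[0, +oo[, continuous omega})
    (omega_gt0 : forall m : R, 0 < m -> 0 < omega m)
    (omega_int :
      (\int[@lebesgue_measure R]_(m in `[1%R, +oo[) (omega m / m ^+ 2)%:E
       = +oo)%E)
    (d : nat) (d_gt0 : (0 < d)%N)
    (Omega : set 'rV[R]_d) (Omega_open : open Omega)
    (Omega_connected : connected Omega)
    (u : 'rV[R]_d -> R) (u_Linfty : Linfty Omega u)
    (u_nonconst : ~ ess_constant Omega u)
    (u_diff : {ae @leb R d, forall x, Omega x ->
                 approx_differentiable Omega u x}) :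
  nonlocal_energy omega u Omega = +oo%E.
Proof.
case: d d_gt0 Omega Omega_open Omega_connected u u_Linfty u_nonconst u_diff
  => [//|n] _ Omega Omega_open Omega_connected u u_Linfty u_nonconst u_diff.
exact: energy_infinite_succ.
Qed.
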